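(* Let $\{u_n\}_{n\ge 0}$ be any one of the fifteen sporadic sequences $\mathbf{A},\mathbf{B},\mathbf{C},\mathbf{D},\mathbf{E},\mathbf{F},(\delta),(\eta),(\alpha),(\epsilon),(\zeta),(\gamma),s_7,s_{10},s_{18}$ defined below, and let $k=2$ if the sequence is one of $\mathbf{A},\dots,\mathbf{F}$ (these satisfy second-order recurrences/differential equations) and $k=3$ otherwise (these satisfy third-order ones). Then: (i) there is a Laurent polynomial $\Lambda\in\mathbb{Z}[x_1^{\pm1},\dots,x_k^{\pm1}]$ in $k$ variables such that $u_n=\mathrm{CT}(\Lambda^n)$ for every $n\ge 1$; (ii) such a $\Lambda$ (with $u_n=\mathrm{CT}(\Lambda^n)$ for all $n\ge1$) can be chosen so that it factors as a product of Laurent polynomials each of whose coefficients lie in $\{-1,0,1\}$; (iii) if the sequence is not $(\eta)$, such a $\Lambda$ (with integer coefficients and $u_n=\mathrm{CT}(\Lambda^n)$ for all $n\ge1$) can be chosen so that its Newton polytope contains the origin as its only interior integral point.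
   Context: For a Laurent polynomial (or series) $f$, $\mathrm{CT}(f)$ denotes its constant term (the coefficient of $x_1^0\cdots x_d^0$). The Newton polytope of a Laurent polynomial $\sum c_{\mathbf a}x^{\mathbf a}$ is the convex hull in $\mathbb{R}^d$ of $\{\mathbf a\in\mathbb{Z}^d: c_{\mathbf a}\ne0\}$. The sequences are defined by recurrences with $u_{-1}=0$, $u_0=1$: Zagier-type: $(n+1)^2u_{n+1}-(An^2+An+\lambda)u_n+Bn^2u_{n-1}=0$ for $n\ge0$, with $(A,B,\lambda)=(7,-8,2)$ for $\mathbf{A}$, $(9,27,3)$ for $\mathbf{B}$, $(10,9,3)$ for $\mathbf{C}$, $(11,-1,3)$ for $\mathbf{D}$, $(12,32,4)$ for $\mathbf{E}$, $(17,72,6)$ for $\mathbf{F}$. Cooper-type: $(n+1)^3u_{n+1}-(2n+1)(an^2+an+b)u_n+n(cn^2+d)u_{n-1}=0$ for $n\ge0$, with $(a,b,c,d)=(7,3,81,0)$ for $(\delta)$, $(11,5,125,0)$ for $(\eta)$, $(10,4,64,0)$ for $(\alpha)$, $(12,4,16,0)$ for $(\epsilon)$, $(9,3,-27,0)$ for $(\zeta)$, $(17,5,1,0)$ for $(\gamma)$, $(13,4,-27,3)$ for $s_7$, $(6,2,-64,4)$ for $s_{10}$, $(14,6,192,-12)$ for $s_{18}$. (For instance $\mathbf{A}$: $u_n=\sum_k\binom nk^3$; $\mathbf{D}$: $u_n=\sum_k\binom nk^2\binom{n+k}{n}$; $(\gamma)$: $u_n=\sum_k\binom nk^2\binom{n+k}{k}^2$;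 $s_{10}$: $u_n=\sum_k\binom nk^4$.) *)

(* Defs.v *)
From HB Require Import structures.
From mathcomp Require Import all_boot all_order all_algebra.
From mathcomp Require Import finmap monalg ring.
From mathcomp Require Import all_classical all_reals all_analysis.

Set Implicit Arguments.
Unset Strict Implicit.
Unset Printing Implicit Defensive.

Import Order.TTheory GRing.Theory Num.Theory.
Import numFieldNormedType.Exports.

Local Open Scope classical_set_scope.
Local Open Scope ring_scope.

(* [monalg] only builds a ring on [{malg G[K]}] when the identity is the sole
   unit of the monoid [K], which fails for the exponent group Z^k. *)
Definition laurent (k : nat) : Type := {malg int['rV[int]_k]}.

HB.instance Definition _ (k : nat) :=
  GRing.Zmodule.on (laurent k).

Section LaurentRing.
Variable k : nat.
Implicit Types f g h : laurent k.

Definition laurent_mul f g : laurent k :=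
  \sum_(a <- msupp f) \sum_(b <- msupp g)
    << (f@_a * g@_b) *g (a + b)%R >>.

Definition laurent_one : laurent k := << 1 *g 0%R >>.

Local Notation "f *L g" := (laurent_mul f g) (at level 40).

Lemma laurent_mulEw (A B : {fset 'rV[int]_k}) f g :
  (msupp f `<=` A)%fset -> (msupp g `<=` B)%fset ->
  f *L g = \sum_(a <- A) \sum_(b <- B) << (f@_a * g@_b) *g (a + b)%R >>.
Proof.
move=> fA gB; rewrite /laurent_mul (big_fset_incl _ fA) /=.
  apply: eq_bigr => a _; apply: big_fset_incl => // b _ /mcoeff_outdom ->.
  by rewrite mulr0 monalgU0.
move=> a _ /mcoeff_outdom fa.
by rewrite big1 // => b _; rewrite fa mul0r monalgU0.
Qed.

Lemma laurent_mulC : commutative laurent_mul.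
Proof.
move=> f g; rewrite /laurent_mul exchange_big; apply: eq_bigr => b _.
by apply: eq_bigr => a _; rewrite mulrC addrC.
Qed.

Lemma laurent_mulDl : left_distributive laurent_mul +%R.
Proof.
move=> f g h.
rewrite [in RHS](laurent_mulEw (fsubsetUl _ (msupp g)) (fsubset_refl _)).
rewrite [in RHS](laurent_mulEw (fsubsetUr (msupp f) _) (fsubset_refl _)).
rewrite (laurent_mulEw (msuppD_le _ _) (fsubset_refl _)).
rewrite -big_split /=; apply: eq_bigr => a _.
rewrite -big_split /=; apply: eq_bigr => b _.
by rewrite mcoeffD mulrDl monalgUD.
Qed.

Lemma laurent_mulDr : right_distributive laurent_mul +%R.
Proof. by move=> f g h; rewrite !(laurent_mulC f) laurent_mulDl. Qed.

Lemma laurent_mul0l : left_zero 0 laurent_mul.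
Proof. by move=> f; rewrite /laurent_mul msupp0 big_seq_fset0. Qed.

Lemma laurent_mul0r : right_zero 0 laurent_mul.
Proof. by move=> f; rewrite laurent_mulC laurent_mul0l. Qed.

Lemma laurent_mulUU (c d : int) (a b : 'rV[int]_k) :
  (<< c *g a >> : laurent k) *L << d *g b >> = << (c * d) *g (a + b)%R >>.
Proof.
by rewrite (laurent_mulEw msuppU_le msuppU_le) !big_seq_fset1 !mcoeffUU.
Qed.

Lemma laurent_mulA : associative laurent_mul.
Proof.
pose mL h := big_morph (laurent_mul^~ h) (fun _ _ => laurent_mulDl _ _ _)
  (laurent_mul0l h).
pose mR h := big_morph (laurent_mul h) (fun _ _ => laurent_mulDr _ _ _)
  (laurent_mul0r h).
move=> f g h; rewrite [f]monalgE [g]monalgE [h]monalgE.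
rewrite [LHS]mL [X in _ = X *L _]mL [RHS]mL; apply: eq_bigr => a _.
rewrite [X in _ *L X = _]mL [LHS]mR [X in _ = X *L _]mR [RHS]mL.
apply: eq_bigr => b _.
rewrite [X in _ *L X = _]mR [LHS]mR [RHS]mR; apply: eq_bigr => c _.
by rewrite !laurent_mulUU mulrA addrA.
Qed.

Lemma laurent_mul1l : left_id laurent_one laurent_mul.
Proof.
move=> f; rewrite (laurent_mulEw msuppU_le (fsubset_refl _)) big_seq_fset1.
rewrite [RHS]monalgE; apply: eq_bigr => a _.
by rewrite mcoeffUU mul1r add0r.
Qed.

Lemma laurent_one_neq0 : laurent_one != 0.
Proof. by apply/eqP => /malgP /(_ 0%R); rewrite mcoeffUU mcoeff0. Qed.

End LaurentRing.

HB.instance Definition _ (k : nat) :=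
  GRing.Zmodule_isComNzRing.Build (laurent k) (@laurent_mulA k)
    (@laurent_mulC k) (@laurent_mul1l k) (@laurent_mulDl k)
    (@laurent_one_neq0 k).

Definition CT (k : nat) (f : laurent k) : int := f@_(0%R : 'rV[int]_k).

Definition CT_represents (k : nat) (L : laurent k) (u : nat -> rat) : Prop :=
  forall n : nat, (1 <= n)%N -> u n = (CT (L ^+ n))%:~R.

Definition ternary_coefs (k : nat) (f : laurent k) : Prop :=
  forall a : 'rV[int]_k, f@_a \in [:: -1; 0; 1].

Definition lattice_point (R : realType) (k : nat) (a : 'rV[int]_k) :
    'rV[R]_k := map_mx intr a.
Arguments lattice_point R {k} a.

Definition newton_polytope (R : realType) (k : nat) (f : laurent k) :
    set 'rV[R]_k :=
  smallest (@convex_set R 'rV[R]_k)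
    [set lattice_point R a | a in [set a : 'rV[int]_k | f@_a != 0]].
Arguments newton_polytope R {k} f.

Definition origin_only_interior_point (R : realType) (k : nat)
    (f : laurent k) : Prop :=
  forall a : 'rV[int]_k,
    (newton_polytope R f)° (lattice_point R a) <-> a = 0.
Arguments origin_only_interior_point R {k} f.

(* [u_(n-1)], with the convention [u_(-1) = 0]. *)
Definition pred_term (u : nat -> rat) (n : nat) : rat :=
  if n is m.+1 then u m else 0.

Definition zagier_type (A B lambda : rat) (u : nat -> rat) : Prop :=
  u 0%N = 1 /\
  forall n : nat,
    (n%:R + 1) ^+ 2 * u n.+1 - (A * n%:R ^+ 2 + A * n%:R + lambda) * u n
      + B * n%:R ^+ 2 * pred_term u n = 0.

Definition cooper_type (a b c d : rat) (u : nat -> rat) : Prop :=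
  u 0%N = 1 /\
  forall n : nat,
    (n%:R + 1) ^+ 3 * u n.+1
      - (2 * n%:R + 1) * (a * n%:R ^+ 2 + a * n%:R + b) * u n
      + n%:R * (c * n%:R ^+ 2 + d) * pred_term u n = 0.

Inductive sporadic : Set :=
  | spA | spB | spC | spD | spE | spF
  | sp_delta | sp_eta | sp_alpha | sp_epsilon | sp_zeta | sp_gamma
  | sp_s7 | sp_s10 | sp_s18.

Definition is_sporadic_seq (s : sporadic) : (nat -> rat) -> Prop :=
  match s with
  | spA => zagier_type 7 (- 8) 2
  | spB => zagier_type 9 27 3
  | spC => zagier_type 10 9 3
  | spD => zagier_type 11 (- 1) 3
  | spE => zagier_type 12 32 4
  | spF => zagier_type 17 72 6
  | sp_delta => cooper_type 7 3 81 0
  | sp_eta => cooper_type 11 5 125 0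
  | sp_alpha => cooper_type 10 4 64 0
  | sp_epsilon => cooper_type 12 4 16 0
  | sp_zeta => cooper_type 9 3 (- 27) 0
  | sp_gamma => cooper_type 17 5 1 0
  | sp_s7 => cooper_type 13 4 (- 27) 3
  | sp_s10 => cooper_type 6 2 (- 64) 4
  | sp_s18 => cooper_type 14 6 192 (- 12)
  end.

(* The recurrences divide by [n + 1], so [u] is only known to be rational. *)
Lemma three_term_rec_exists (D P Q : nat -> rat) :
  (forall n, D n != 0) ->
  exists u : nat -> rat, u 0%N = 1 /\
    forall n, D n * u n.+1 - P n * u n + Q n * pred_term u n = 0.
Proof.
move=> D0.
pose step n (p : rat * rat) := ((P n * p.1 - Q n * p.2) / D n, p.1).
pose v := fix v n := if n is m.+1 then step m (v m) else (1, 0) : rat * rat.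
exists (fun n => (v n).1); split=> // n.
have -> : pred_term (fun n => (v n).1) n = (v n).2 by case: n.
by rewrite /= mulrC divfK //; ring.
Qed.

Lemma is_sporadic_seq_exists (s : sporadic) :
  exists u : nat -> rat, is_sporadic_seq s u.
Proof.
have n1 (e n : nat) : (n%:R + 1 : rat) ^+ e != 0.
  by rewrite expf_neq0 // -natr1E pnatr_eq0.
by case: s; apply: three_term_rec_exists.
Qed.

Definition nvars (s : sporadic) : nat :=
  match s with
  | spA | spB | spC | spD | spE | spF => 2
  | _ => 3
  end.

(* Main.v *)
(* Writing [v n] for the constant term of [L ^ n], the recurrence for [v] holds
   because the operator applied to [L ^ n] is a sum of Euler derivatives
   [x_i d/dx_i (G_i L ^ (n - 1))], and an Euler derivative has no constant term.
   After division by [L ^ (n - 2)] this is an identity between Laurent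
   polynomials whose coefficients are polynomials in [n]; the [G_i] were found
   by linear algebra and the identities are checked by computation.

   The less obvious Laurent polynomials come from simple ones by mutations, i.e.
   substitutions [y := y * r] that preserve constant terms of powers, with [r]
   a Laurent polynomial in the other variables. *)

From Stdlib Require Import ZArith.
Require Import Defs.
From mathcomp Require Import all_boot all_order all_algebra.
From mathcomp Require Import finmap monalg ssrZ ring lra zify.
From mathcomp Require Import unstable.
From mathcomp Require Import all_classical all_reals all_analysis.

Set Implicit Arguments.
Unset Strict Implicit.
Unset Printing Implicit Defensive.

Import Order.TTheory GRing.Theory Num.Theory.
Import numFieldNormedType.Exports.

Local Open Scope classical_set_scope.
Local Open Scope ring_scope.

(** * Constant terms of Euler derivatives *)

(* An abstract ring stands for [laurent k], whose product the unifier would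
   unfold at great cost; likewise for [A] in section [Evaluation]. *)
Section Derivations.
Variables (A : comNzRingType) (V : nmodType) (I : finType).
Variables (D : I -> A -> A) (T : A -> V).
Hypothesis DD : forall i, {morph D i : f g / f + g}.

Lemma leibniz_of_monomials (M : Type) (addM : M -> M -> M)
    (U : int -> M -> A) (w : I -> M -> int) :
    (forall P : A -> Prop, (forall c a, P (U c a)) ->
       (forall f g, P f -> P g -> P (f + g)) -> forall f, P f) ->
    (forall a, {morph U^~ a : c d / c + d}) ->
    (forall c d a b, U c a * U d b = U (c * d) (addM a b)) ->
    (forall i a b, w i (addM a b) = w i a + w i b) ->
    (forall i c a, D i (U c a) = U (c * w i a) a) ->
  forall i f g, D i (f * g) = D i f * g + f * D i g.
Proof.
move=> ind UD UM wD DU i f g; elim/ind: f => [c a|f f' IHf IHf']; last first.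
  by rewrite mulrDl !DD IHf IHf' !mulrDl addrACA.
elim/ind: g => [d b|g g' IHg IHg']; last first.
  by rewrite mulrDr !DD IHg IHg' !mulrDr addrACA.
by rewrite !(UM, DU) wD -UD; congr U; ring.
Qed.

Hypothesis DM : forall i f g, D i (f * g) = D i f * g + f * D i g.

Lemma derivationX i f n : D i (f ^+ n.+1) = (f ^+ n * D i f) *+ n.+1.
Proof.
elim: n => [|n IHn]; first by rewrite expr1 expr0 mul1r.
by rewrite exprS DM IHn [in RHS]mulrS mulrnAr mulrA -exprS [_ * f ^+ _]mulrC.
Qed.

Hypothesis TD : {morph T : f g / f + g}.
Hypothesis T0 : T 0 = 0.
Hypothesis T_D : forall i f, T (D i f) = 0.

Lemma telescoping f (G : I -> A) n :
  T (f ^+ n * (f * (\sum_i D i (G i)) + (\sum_i G i * D i f) *+ n.+1)) = 0.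
Proof.
suff ->: f ^+ n * (f * (\sum_i D i (G i)) + (\sum_i G i * D i f) *+ n.+1)
         = \sum_i D i (G i * f ^+ n.+1).
  by rewrite (big_morph _ TD T0) big1.
rewrite -sumrMnl mulr_sumr -big_split mulr_sumr.
apply: eq_bigr => i _ /=.
by rewrite DM derivationX exprS; ring.
Qed.

End Derivations.

Section Euler.
Variable k : nat.
Implicit Types (f g : laurent k) (i : 'I_k) (a b : 'rV[int]_k).

Definition euler i f : laurent k := [malg a in msupp f => f@_a * a 0 i].

Lemma mcoeff_euler i f a : (euler i f)@_a = f@_a * a 0 i.
Proof. by rewrite mcoeffE; case: msuppP => // _; rewrite mul0r. Qed.

Lemma eulerD i : {morph euler i : f g / f + g}.
Proof.
by move=> f g; apply/malgP => a; rewrite !mcoeffD !mcoeff_euler mcoeffD mulrDl.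
Qed.

Lemma laurent_ind (P : laurent k -> Prop) :
    (forall c a, P << c *g a >>) -> (forall f g, P f -> P g -> P (f + g)) ->
  forall f, P f.
Proof.
move=> PU PD f; rewrite [f]monalgE; elim/big_ind: _ => [|//|a _ //].
by have := PU 0 0; rewrite monalgU0.
Qed.

Lemma eulerU i (c : int) a :
  euler i (<< c *g a >> : laurent k) = << c * a 0 i *g a >>.
Proof.
apply/malgP => b; rewrite mcoeff_euler [X in X * _]mcoeffU [RHS]mcoeffU.
by case: eqVneq => [->|_]; rewrite ?mulr1n // mulr0n mul0r.
Qed.

Lemma eulerM i f g : euler i (f * g) = euler i f * g + f * euler i g.
Proof.
apply: (leibniz_of_monomials eulerD (addM := +%R) (w := fun i a => a 0 i)
  laurent_ind _ (@laurent_mulUU k) _ eulerU) => [a c d|j a b].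
  exact: monalgUD.
exact: mxE.
Qed.

Lemma CT_euler i f : CT (euler i f) = 0.
Proof. by rewrite /CT mcoeff_euler mxE mulr0. Qed.

Lemma CTD : {morph @CT k : f g / f + g}.
Proof. by move=> f g; exact: mcoeffD. Qed.

Lemma CT0 : CT (0 : laurent k) = 0.
Proof. exact: mcoeff0. Qed.

End Euler.

(** * Computing with Laurent polynomials as sorted lists of monomials *)

(* A monomial is an exponent vector with a coefficient in Z[n], the latter
   given by the list of its coefficients in increasing degree. *)
Definition lpoly := seq (seq Z * seq Z).

Fixpoint zadd (p q : seq Z) : seq Z :=
  match p, q with
  | [::], _ => q
  | _, [::] => p
  | a :: p', b :: q' => Z.add a b :: zadd p' q'
  end.

Definition zscale (a : Z) : seq Z -> seq Z := map (Z.mul a).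

Fixpoint zmul (p q : seq Z) : seq Z :=
  if p is a :: p' then zadd (zscale a q) (Z0 :: zmul p' q) else [::].

Definition znull : seq Z -> bool := all (fun a => if a is Z0 then true else false).

Fixpoint zlex (e f : seq Z) : comparison :=
  match e, f with
  | [::], [::] => Eq
  | [::], _ => Lt
  | _, [::] => Gt
  | a :: e', b :: f' => if Z.compare a b is Eq then zlex e' f' else Z.compare a b
  end.

(* A merge: exponents must be sorted for terms to cancel, but the value of the
   sum does not depend on it. *)
Fixpoint lpadd (p : lpoly) : lpoly -> lpoly :=
  if p is (e, c) :: p' then
    fix add_p (q : lpoly) : lpoly :=
      if q is (f, d) :: q' then
        match zlex e f with
        | Lt => (e, c) :: lpadd p' q
        | Gt => (f, d) :: add_p q'
        | Eq => let s := zadd c d in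
                if znull s then lpadd p' q' else (e, s) :: lpadd p' q'
        end
      else p
  else id.

Definition lpshift (t : seq Z * seq Z) : lpoly -> lpoly :=
  map (fun s => (zadd t.1 s.1, zmul t.2 s.2)).

Definition lpmul (p q : lpoly) : lpoly :=
  foldr (fun t => lpadd (lpshift t q)) [::] p.

Definition lpeuler (i : nat) : lpoly -> lpoly :=
  map (fun t => (t.1, zscale (nth Z0 t.1 i) t.2)).

Definition lpscale (c : seq Z) : lpoly -> lpoly := lpshift ([::], c).

Definition lpsum : seq lpoly -> lpoly := foldr lpadd [::].

Definition lpprod : seq lpoly -> lpoly := foldr lpmul [:: ([::], [:: Zpos 1])].

Definition lpnull : lpoly -> bool := all (fun t => znull t.2).

Definition lpconst (p : lpoly) : bool := all (fun t => (size t.2 <= 1)%N) p.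

Definition zvec k (e : seq Z) : 'rV[int]_k := \row_i int_of_Z (nth Z0 e i).

Definition zeval (n : int) (c : seq Z) : int :=
  foldr (fun z acc => int_of_Z z + n * acc) 0 c.

Definition zeqk k (e f : seq Z) : bool :=
  znull (take k (zadd e (zscale (Zneg 1) f))).

Definition lpcoef k (e : seq Z) (p : lpoly) : seq Z :=
  foldr (fun t => if zeqk k t.1 e then zadd t.2 else id) [::] p.

Definition lpct k : lpoly -> seq Z := lpcoef k [::].

Lemma zevalD n c d : zeval n (zadd c d) = zeval n c + zeval n d.
Proof.
elim: c d => [|a c IHc] [|b d] /=; rewrite ?add0r ?addr0 // IHc rmorphD; ring.
Qed.

Lemma zevalZ n a c : zeval n (zscale a c) = int_of_Z a * zeval n c.
Proof. by elim: c => [|b c IHc] /=; rewrite ?mulr0 // IHc rmorphM; ring. Qed.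

Lemma zevalM n c d : zeval n (zmul c d) = zeval n c * zeval n d.
Proof.
by elim: c => [|a c IHc]; rewrite ?mul0r //= zevalD zevalZ /= IHc rmorph0; ring.
Qed.

Lemma zeval_null n c : znull c -> zeval n c = 0.
Proof.
by elim: c => //= -[] // c IHc /IHc ->; rewrite mulr0.
Qed.

Lemma zeval_const n m c : (size c <= 1)%N -> zeval n c = zeval m c.
Proof. by case: c => [|a [|b c]] //= _; rewrite !mulr0. Qed.

Lemma nth_zadd e f i :
  nth Z0 (zadd e f) i = Z.add (nth Z0 e i) (nth Z0 f i).
Proof.
by elim: e f i => [|a e IHe] [|b f] [|i] //=; rewrite ?Z.add_0_r.
Qed.

Lemma zvecD k e f : zvec k (zadd e f) = zvec k e + zvec k f.
Proof. by apply/rowP => i; rewrite !mxE nth_zadd rmorphD. Qed.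

Lemma zvec_eq0 k e : (zvec k e == 0) = znull (take k e).
Proof.
apply/eqP/(all_nthP Z0) => [e0 i|e0].
  rewrite size_take_min leq_min => /andP[ik _].
  move/rowP: e0 => /(_ (Ordinal ik)); rewrite !mxE nth_take //= => e0.
  by rewrite (can_inj int_of_ZK (e0 : _ = int_of_Z Z0)).
apply/rowP => i; rewrite !mxE.
have [ie|ie] := ltnP i (size e); last by rewrite nth_default.
have := e0 i; rewrite size_take_min leq_min ltn_ord ie nth_take //.
by move=> /(_ isT); case: nth.
Qed.

Lemma zvec_eq k e f : (zvec k e == zvec k f) = zeqk k e f.
Proof.
rewrite /zeqk -zvec_eq0 zvecD addr_eq0; congr (_ == _).
apply/rowP => i; rewrite !mxE /zscale.
have -> : nth Z0 [seq Z.mul (Zneg 1) j | j <- f] i = Z.opp (nth Z0 f i).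
  by elim: f (val i) => [|b f IHf] [|m] //=; rewrite IHf.
by rewrite (rmorphN int_of_Z) opprK.
Qed.

Lemma zvec_nil k : zvec k [::] = 0.
Proof. by apply/eqP; rewrite zvec_eq0. Qed.

Lemma zlex_eq e f : zlex e f = Eq -> e = f.
Proof.
elim: e f => [|a e IHe] [|b f] //=.
by case: Z.compare_spec => // -> /IHe ->.
Qed.

Lemma morph_mulz (V W : zmodType) (h : V -> W) (x : V) (c : int) :
  {morph h : y z / y + z} -> h (x *~ c) = h x *~ c.
Proof.
move=> hD; have h0 : h 0 = 0 by apply: (addrI (h 0)); rewrite -hD !addr0.
have hMn n : h (x *+ n) = h x *+ n.
  by elim: n => [|n IHn]; rewrite ?mulr0n // !mulrS hD IHn.
case: c => n; first by rewrite -!pmulrn hMn.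
rewrite NegzE !mulrNz -!pmulrn -hMn.
by apply/eqP; rewrite -addr_eq0 -hD addNr h0.
Qed.

Section Evaluation.
Variables (k : nat) (A : comNzRingType) (U : int -> 'rV[int]_k -> A).
Variables (D : 'I_k -> A -> A) (T : A -> int).
Hypothesis UD : forall a, {morph U^~ a : c d / c + d}.
Hypothesis UM : forall c d a b, U c a * U d b = U (c * d) (a + b).
Hypothesis U1 : U 1 0 = 1.
Hypothesis DD : forall i, {morph D i : f g / f + g}.
Hypothesis DU : forall i c a, D i (U c a) = U (c * a 0 i) a.
Hypothesis TD : {morph T : f g / f + g}.

Definition lpeval (n : int) (p : lpoly) : A :=
  \sum_(t <- p) U (zeval n t.2) (zvec k t.1).

Let U0 a : U 0 a = 0.
Proof. by apply: (addrI (U 0 a)); rewrite -UD !addr0. Qed.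

Let Uc c : U c 0 = c%:~R.
Proof. by rewrite -[c in LHS]intz (morph_mulz 1 c (UD 0)) U1. Qed.

Let D0 i : D i 0 = 0.
Proof. by apply: (addrI (D i 0)); rewrite -DD !addr0. Qed.

Let T0 : T 0 = 0.
Proof. by apply: (addrI (T 0)); rewrite -TD !addr0. Qed.

Lemma lpevalD n p q : lpeval n (lpadd p q) = lpeval n p + lpeval n q.
Proof.
rewrite /lpeval; elim: p q => [|[e c] p IHp] q; first by rewrite big_nil add0r.
elim: q => [|[f d] q IHq]; first by rewrite big_nil addr0.
have -> : lpadd ((e, c) :: p) ((f, d) :: q) =
    match zlex e f with
    | Lt => (e, c) :: lpadd p ((f, d) :: q)
    | Gt => (f, d) :: lpadd ((e, c) :: p) q
    | Eq => let s := zadd c d in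
            if znull s then lpadd p q else (e, s) :: lpadd p q
    end by [].
case ef: (zlex e f); rewrite /= ?[in LHS]big_cons ?IHp ?IHq !big_cons /=; [|ring..].
have -> : U (zeval n c) (zvec k e) + \sum_(t <- p) U (zeval n t.2) (zvec k t.1) +
    (U (zeval n d) (zvec k f) + \sum_(t <- q) U (zeval n t.2) (zvec k t.1)) =
    U (zeval n (zadd c d)) (zvec k e) + (\sum_(t <- p) U (zeval n t.2) (zvec k t.1)
      + \sum_(t <- q) U (zeval n t.2) (zvec k t.1)).
  by rewrite (zlex_eq ef) zevalD UD; ring.
rewrite -IHp; case: ifP => [cd0|_]; last by rewrite big_cons.
by rewrite zeval_null // U0 add0r.
Qed.

Lemma lpeval_shift n t p :
  lpeval n (lpshift t p) = U (zeval n t.2) (zvec k t.1) * lpeval n p.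
Proof.
rewrite /lpeval big_map mulr_sumr; apply: eq_bigr => s _.
by rewrite zevalM zvecD UM.
Qed.

Lemma lpevalM n p q : lpeval n (lpmul p q) = lpeval n p * lpeval n q.
Proof.
elim: p => [|t p IHp]; first by rewrite /lpeval !big_nil mul0r.
by rewrite /= lpevalD lpeval_shift IHp {4}/lpeval big_cons mulrDl.
Qed.

Lemma lpeval_scale n c p : lpeval n (lpscale c p) = (zeval n c)%:~R * lpeval n p.
Proof.
rewrite lpeval_shift /= -Uc; congr (U _ _ * _).
by apply/eqP; rewrite zvec_eq0.
Qed.

Lemma lpeval_euler n (i : 'I_k) p : lpeval n (lpeuler i p) = D i (lpeval n p).
Proof.
rewrite /lpeval big_map (big_morph _ (DD i) (D0 i)).
by apply: eq_bigr => t _; rewrite zevalZ DU mxE mulrC.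
Qed.

Lemma lpeval_sum n ps : lpeval n (lpsum ps) = \sum_(p <- ps) lpeval n p.
Proof.
elim: ps => [|p ps IHps]; first by rewrite /lpeval !big_nil.
by rewrite /= lpevalD IHps big_cons.
Qed.

Lemma lpeval_prod n ps : lpeval n (lpprod ps) = \prod_(p <- ps) lpeval n p.
Proof.
elim: ps => [|p ps IHps]; last by rewrite /= lpevalM IHps big_cons.
rewrite /lpeval big_nil big_seq1 /= mulr0 addr0 -[RHS]U1; congr (U _ _).
by apply/eqP; rewrite zvec_eq0.
Qed.

Lemma lpeval_null n p : lpnull p -> lpeval n p = 0.
Proof.
move=> /allP p0; rewrite /lpeval big_seq big1 // => t /p0 t0.
by rewrite zeval_null ?U0.
Qed.

Lemma lpeval_const n m p : lpconst p -> lpeval n p = lpeval m p.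
Proof.
move=> /allP p1; apply: eq_big_seq => t /p1 t1.
by rewrite (zeval_const n m t1).
Qed.

Lemma lpeval_coef n e p : (forall c a, T (U c a) = c *+ (a == zvec k e)) ->
  T (lpeval n p) = zeval n (lpcoef k e p).
Proof.
move=> TU; elim: p => [|t p IHp]; first by rewrite /lpeval big_nil T0.
rewrite /lpeval big_cons TD -/(lpeval n p) IHp TU zvec_eq /=.
by case: ifP; rewrite ?zevalD // add0r.
Qed.

Lemma lpeval_support n p (b : 'rV[int]_k) :
    (forall c a, T (U c a) = c *+ (a == b)) -> T (lpeval n p) != 0 ->
  exists2 t, t \in p & b = zvec k t.1.
Proof.
move=> TU; elim: p => [|t p IHp]; first by rewrite /lpeval big_nil T0 eqxx.
rewrite /lpeval big_cons TD TU; have [<- _|_] := eqVneq (zvec k t.1) b.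
  by exists t; rewrite ?mem_head.
by rewrite add0r => /IHp[s sp ->]; exists s; rewrite // inE sp orbT.
Qed.

(* The data [(P2, P1, P0)] stand for the recurrence
   [P2(n) u_(n+1) + P1(n) u_n + P0(n) u_(n-1) = 0]. The identity below, times
   [L ^ (n - 2)], exhibits the recurrence operator applied to [L ^ n] as a sum of
   Euler derivatives; it says nothing for [n < 2], hence the last two tests. *)
Definition lpcert (P : seq Z * seq Z * seq Z) (d : Z) (L : lpoly)
    (G : seq lpoly) : bool :=
  let: (P2, P1, P0) := P in
  let L2 := lpmul L L in
  let I := index_iota 0 k in
  [&& lpconst L, d != Z0,
      lpnull (lpadd
        (lpscale [:: d] (lpadd (lpscale P2 (lpmul L L2))
                               (lpadd (lpscale P1 L2) (lpscale P0 L))))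
        (lpscale [:: Zneg 1] (lpadd
          (lpmul L (lpsum [seq lpeuler i (nth [::] G i) | i <- I]))
          (lpscale [:: Zneg 1; Zpos 1]
            (lpsum [seq lpmul (lpeuler i L) (nth [::] G i) | i <- I]))))),
      zeval 0 P2 * zeval 0 (lpct k L) + zeval 0 P1 == 0 &
      zeval 1 P2 * zeval 0 (lpct k L2) + zeval 1 P1 * zeval 0 (lpct k L)
        + zeval 1 P0 == 0].

Hypothesis DM : forall i f g, D i (f * g) = D i f * g + f * D i g.
Hypothesis T_D : forall i f, T (D i f) = 0.
Hypothesis TU0 : forall c a, T (U c a) = c *+ (a == 0).

Lemma lpcert_recurrence P2 P1 P0 d L G : lpcert (P2, P1, P0) d L G ->
  let v n := T (lpeval 0 L ^+ n) in
  forall n : nat, zeval n P2 * v n.+1 + zeval n P1 * v n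
    + zeval n P0 * (if n is m.+1 then v m else 0) = 0.
Proof.
case/and5P => L1 d0 /lpeval_null id0 /eqP init0 /eqP init1 v.
have v0 : v 0%N = 1 by rewrite /v expr0 -U1 TU0 eqxx.
have TU c a : T (U c a) = c *+ (a == zvec k [::]) by rewrite zvec_nil.
have v1 : v 1%N = zeval 0 (lpct k L) by rewrite /v expr1 (lpeval_coef _ _ TU).
have v2 : v 2 = zeval 0 (lpct k (lpmul L L)).
  by rewrite -(lpeval_coef _ _ TU) lpevalM.
case=> [|[|n]].
- by rewrite v0 v1 mulr1 mulr0 addr0.
- by rewrite v0 v1 v2 mulr1.
have TZ c f : T (c%:~R * f) = c * T f.
  by rewrite mulrC mulrzr (morph_mulz f c TD) mulrzz mulrC.
move: (id0 (n.+2 : int)); set N : int := n.+2.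
rewrite !(lpevalD, lpeval_scale, lpevalM, lpeval_sum) !big_map.
rewrite (lpeval_const N 0 L1).
set f := lpeval 0 L; set S1 := \sum_(_ <- _) _; set S2 := \sum_(_ <- _) _.
have -> : S1 = \sum_(i < k) D i (lpeval N (nth [::] G i)).
  by rewrite /S1 big_mkord; apply: eq_bigr => i _; rewrite lpeval_euler.
have -> : S2 = \sum_(i < k) lpeval N (nth [::] G i) * D i f.
  rewrite /S2 big_mkord; apply: eq_bigr => i _.
  by rewrite lpevalM lpeval_euler (lpeval_const N 0 L1) mulrC.
have := telescoping DM TD T0 T_D f (fun i => lpeval N (nth [::] G i)) n.
set R1 := \sum_i _; set R2 := \sum_i _ => tel /(congr1 (fun g => T (f ^+ n * g))).
rewrite mulr0 T0.
have -> : zeval N [:: Zneg 1; Zpos 1] = n.+1.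
  by rewrite /zeval /= mulr0 addr0 mulr1 /N; lia.
have -> : zeval N [:: Zneg 1] = -1 by rewrite /zeval /= mulr0 addr0.
have -> : zeval N [:: d] = int_of_Z d by rewrite /zeval /= mulr0 addr0.
set p2 := zeval N P2; set p1 := zeval N P1; set p0 := zeval N P0.
have -> : f ^+ n * ((int_of_Z d)%:~R * (p2%:~R * (f * (f * f)) +
     (p1%:~R * (f * f) + p0%:~R * f)) + (-1)%:~R * (f * R1 + n.+1%:~R * R2))
   = (int_of_Z d * p2)%:~R * f ^+ n.+3 + ((int_of_Z d * p1)%:~R * f ^+ n.+2
     + ((int_of_Z d * p0)%:~R * f ^+ n.+1
     + (-1)%:~R * (f ^+ n * (f * R1 + R2 *+ n.+1)))).
  by rewrite !exprS -pmulrn; ring.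
rewrite !TD !TZ tel mulr0 addr0 -!mulrA -!mulrDr => /eqP.
rewrite mulf_eq0 => /orP[/eqP dd|/eqP]; last by rewrite addrA.
by case/eqP: d0; apply: (can_inj int_of_ZK).
Qed.

End Evaluation.

Definition laurent_monomial k (c : int) (a : 'rV[int]_k) : laurent k :=
  << c *g a >>.

Definition laurent_of k (p : lpoly) : laurent k :=
  lpeval (@laurent_monomial k) 0 p.

Lemma mcoeff_laurent_of k e p :
  (laurent_of k p)@_(zvec k e) = zeval 0 (lpcoef k e p).
Proof.
apply: (lpeval_coef (U := @laurent_monomial k)
  (T := fun f : laurent k => f@_(zvec k e))) => [f g|c a].
- exact: mcoeffD.
- exact: mcoeffU.
Qed.

Lemma laurent_of_support k p (a : 'rV[int]_k) :
  (laurent_of k p)@_a != 0 -> exists2 t, t \in p & a = zvec k t.1.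
Proof.
apply: (lpeval_support (U := @laurent_monomial k)
  (T := fun f : laurent k => f@_a)) => [f g|c b].
- exact: mcoeffD.
- exact: mcoeffU.
Qed.

Lemma laurent_of_prod k ps :
  laurent_of k (lpprod ps) = \prod_(p <- ps) laurent_of k p.
Proof.
apply: (lpeval_prod (U := @laurent_monomial k)) => [a c d||].
- exact: monalgUD.
- exact: laurent_mulUU.
- by [].
Qed.

Definition lpternary k (p : lpoly) : bool :=
  all (fun t => zeval 0 (lpcoef k t.1 p) \in [:: -1; 0; 1]) p.

Lemma lpternaryP k p : lpternary k p -> ternary_coefs (laurent_of k p).
Proof.
move=> /allP tern a; have [-> //|] := eqVneq (laurent_of k p)@_a 0.
by case/laurent_of_support=> t /tern + ->; rewrite mcoeff_laurent_of.
Qed.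

Definition recurrence (P : seq Z * seq Z * seq Z) (u : nat -> rat) : Prop :=
  u 0%N = 1 /\
  forall n : nat, (zeval n P.1.1)%:~R * u n.+1 + (zeval n P.1.2)%:~R * u n
    + (zeval n P.2)%:~R * pred_term u n = 0.

Lemma recurrence_unique P u v : (forall n : nat, zeval n P.1.1 != 0) ->
  recurrence P u -> recurrence P v -> u =1 v.
Proof.
move=> P0 [u0 ru] [v0 rv].
have P0' (n : nat) : (zeval n P.1.1)%:~R != 0 :> rat by rewrite intr_eq0 P0.
suff uv n : u n = v n /\ u n.+1 = v n.+1 by move=> n; case: (uv n).
elim: n => [|n [IHn IHn1]]; split=> //; first by rewrite u0.
- apply: (mulfI (P0' 0%N)); have := etrans (ru 0%N) (esym (rv 0%N)).
  by rewrite /= u0 v0 => /addIr/addIr.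
- apply: (mulfI (P0' n.+1)); have := etrans (ru n.+1) (esym (rv n.+1)).
  by rewrite /= IHn IHn1 => /addIr/addIr.
Qed.

Lemma lpcert_CT k P d L G u : (forall n : nat, zeval n P.1.1 != 0) ->
    lpcert k P d L G -> recurrence P u ->
  CT_represents (laurent_of k L) u.
Proof.
case: P => [[P2 P1] P0] P2_neq0 cert rec_u n _.
have UD a : {morph (@laurent_monomial k)^~ a : c e / c + e}.
  by move=> c e; exact: monalgUD.
have TU c a : CT (laurent_monomial c a : laurent k) = c *+ (a == 0).
  exact: mcoeffU.
have rec_v := lpcert_recurrence UD (@laurent_mulUU k) erefl (@eulerD k)
  (@eulerU k) (@CTD k) (@eulerM k) (@CT_euler k) TU cert.
apply: (recurrence_unique (v := fun n => (CT (laurent_of k L ^+ n))%:~R)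
  P2_neq0 rec_u); split=> [|m].
  by rewrite expr0 /CT mcoeffUU.
apply: etrans (congr1 (fun c : int => c%:~R : rat) (rec_v m)).
by rewrite !(rmorphD, rmorphM) /=; case: m.
Qed.

Section RecurrenceData.
Local Open Scope Z_scope.

Definition zagier_data (A B l : Z) : seq Z * seq Z * seq Z :=
  ([:: 1; 2; 1], [:: - l; - A; - A], [:: 0; 0; B]).

(* [(2n+1)(a n^2 + a n + b) = 2a n^3 + 3a n^2 + (a + 2b) n + b] *)
Definition cooper_data (a b c d : Z) : seq Z * seq Z * seq Z :=
  ([:: 1; 3; 3; 1], [:: - b; - (a + b + b); - (a + a + a); - (a + a)],
   [:: 0; d; 0; c]).

End RecurrenceData.

Lemma pos_to_nat123 :
  (Pos.to_nat 1 = 1%N) * (Pos.to_nat 2 = 2) * (Pos.to_nat 3 = 3).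
Proof. by []. Qed.

Lemma zeval_rat (n : nat) c :
  (zeval n c)%:~R = foldr (fun z acc => (int_of_Z z)%:~R + n%:R * acc) 0 c :> rat.
Proof. by elim: c => //= z c <-; rewrite rmorphD rmorphM. Qed.

Lemma zagier_recurrence (A B l : Z) u :
    zagier_type (int_of_Z A)%:~R (int_of_Z B)%:~R (int_of_Z l)%:~R u ->
  recurrence (zagier_data A B l) u.
Proof.
case=> u0 rec_u; split=> // n; rewrite -[RHS](rec_u n) !zeval_rat /=.
rewrite !(rmorphN int_of_Z) !rmorphN /= !pos_to_nat123; ring.
Qed.

Lemma cooper_recurrence (a b c d : Z) u :
    cooper_type (int_of_Z a)%:~R (int_of_Z b)%:~R (int_of_Z c)%:~R
      (int_of_Z d)%:~R u ->
  recurrence (cooper_data a b c d) u.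
Proof.
case=> u0 rec_u; split=> // n; rewrite -[RHS](rec_u n) !zeval_rat /=.
rewrite !(rmorphN int_of_Z) !(rmorphD int_of_Z) !rmorphN !rmorphD /=.
by rewrite !pos_to_nat123; ring.
Qed.

Lemma zagier_lead_neq0 A B l (n : nat) : zeval n (zagier_data A B l).1.1 != 0.
Proof. by rewrite /=; lia. Qed.

Lemma cooper_lead_neq0 a b c d (n : nat) :
  zeval n (cooper_data a b c d).1.1 != 0.
Proof. by rewrite /=; lia. Qed.

(** * Newton polytopes *)

Section Convex.
Variables (R : realType) (k : nat).
Implicit Types (S : set 'rV[R]_k) (x y w : 'rV[R]_k).

Lemma convex_set_segment S x y (t : R) : @convex_set R 'rV[R]_k S ->
  0 <= t -> t <= 1 -> S x -> S y -> S (t *: x + (1 - t) *: y).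
Proof.
move=> cS t0 t1 Sx Sy.
by have := cS x y (Itv01 t0 t1); rewrite !inE => /(_ Sx Sy).
Qed.

Lemma convex_set_barycenter S (s : seq (R * 'rV[R]_k)) :
    @convex_set R 'rV[R]_k S -> (forall t, t \in s -> 0 <= t.1 /\ S t.2) ->
    0 < \sum_(t <- s) t.1 ->
  S ((\sum_(t <- s) t.1)^-1 *: \sum_(t <- s) t.1 *: t.2).
Proof.
move=> cS; elim: s => [|[a x] s IHs] sP; first by rewrite big_nil ltxx.
have [/= a0 Sx] := sP _ (mem_head _ _).
have {}sP t : t \in s -> 0 <= t.1 /\ S t.2.
  by move=> ts; apply: sP; rewrite inE ts orbT.
rewrite !big_cons /=; set b := \sum_(t <- s) t.1; set y := \sum_(t <- s) _.
have b0 : 0 <= b by rewrite /b big_seq sumr_ge0 // => t /sP[].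
have [b_eq0|b_neq0] := eqVneq b 0.
  have -> : y = 0.
    rewrite /y big_seq big1 // => t ts; suff -> : t.1 = 0 by rewrite scale0r.
    have := b_eq0; rewrite /b big_seq => /eqP.
    rewrite psumr_eq0 => [/allP/(_ t ts)/implyP/(_ ts)/eqP //|u /sP[] //].
  rewrite b_eq0 !addr0 => a_gt0; by rewrite scalerA mulVf ?scale1r ?gt_eqF.
have b_gt0 : 0 < b by rewrite lt_def b_neq0.
move=> ab_gt0; have := IHs sP b_gt0; rewrite -/b -/y => Sy.
have -> : (a + b)^-1 *: (a *: x + y)
    = (a / (a + b)) *: x + (1 - a / (a + b)) *: (b^-1 *: y).
  rewrite scalerDr !scalerA; congr (_ *: _ + _ *: _); first by rewrite mulrC.
  by field; rewrite !gt_eqF.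
apply: convex_set_segment => //; first by rewrite divr_ge0 // ltW.
by rewrite ler_pdivrMr // mul1r lerDl.
Qed.

Lemma convex_set_nbhs0 S : (0 < k)%N -> @convex_set R 'rV[R]_k S ->
    (forall i (s : bool), exists2 c, 0 < c & S (((-1) ^+ s * c) *: delta_mx 0 i)) ->
  nbhs (0 : 'rV[R]_k) S.
Proof.
move=> k0 cS axis.
have kR : 0 < k%:R :> R by rewrite ltr0n.
exists (fun _ j => [set t : R | S ((k%:R * t) *: delta_mx 0 j)]) => [j i|x Sx].
  rewrite mxE; have [c c0] := axis i false; have [d d0] := axis i true.
  rewrite mulN1r mul1r => Sd Sc; apply/nbhs_ballP.
  exists (Num.min c d / k%:R) => /= [|t].
    by rewrite divr_gt0 // lt_min c0.
  rewrite /ball /= sub0r normrN ltr_pdivlMr // mulrC.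
  rewrite -[k%:R in X in X -> _]gtr0_norm //.
  rewrite -normrM; set u := k%:R * t; rewrite lt_min !ltr_norml.
  move=> /andP[/andP[_ uc] /andP[du _]].
  have -> : u *: delta_mx 0 i = ((u + d) / (c + d)) *: (c *: delta_mx 0 i)
     + (1 - (u + d) / (c + d)) *: (- d *: delta_mx 0 i) :> 'rV[R]_k.
    rewrite !scalerA -scalerDl; congr (_ *: _); field.
    by rewrite gt_eqF // addr_gt0.
  apply: convex_set_segment => //; last first.
    by rewrite ler_pdivrMr ?addr_gt0 // mul1r lerD2r ltW.
  have ud : 0 < u + d by rewrite -ltrBlDr sub0r.
  by apply: divr_ge0; apply: ltW => //; exact: addr_gt0.
pose s := [seq (1 : R, ((k%:R * x 0 i) *: delta_mx 0 i : 'rV[R]_k))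
            | i <- index_enum 'I_k].
have -> : x = (\sum_(t <- s) t.1)^-1 *: \sum_(t <- s) t.1 *: t.2.
  rewrite !big_map /= sumr_const card_ord [LHS]row_sum_delta.
  rewrite scaler_sumr; apply: eq_bigr => i _.
  by rewrite scale1r scalerA mulKf ?gt_eqF.
apply: convex_set_barycenter => // [t /mapP[i _ ->]|] /=.
  by split; rewrite ?ler01 //; apply: Sx.
by rewrite big_map /= sumr_const card_ord.
Qed.

Definition dot w x : R := \sum_i w 0 i * x 0 i.

Lemma dotDr w x y : dot w (x + y) = dot w x + dot w y.
Proof. by rewrite -big_split; apply: eq_bigr => i _; rewrite mxE mulrDr. Qed.

Lemma dotZr w a x : dot w (a *: x) = a * dot w x.
Proof. by rewrite /dot mulr_sumr; apply: eq_bigr => i _; rewrite mxE mulrCA. Qed.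

Lemma halfspace_convex w : @convex_set R 'rV[R]_k [set x | dot w x <= 1].
Proof.
move=> x y t; rewrite !inE /= => wx wy; rewrite /conv /= dotDr !dotZr.
have [t0 t1] : 0 <= t%:num /\ t%:num <= 1 by split.
rewrite /unstable.onem; nra.
Qed.

Lemma interior_halfspace w x :
  [set y | dot w y <= 1]° x -> dot w x < 1 \/ w = 0.
Proof.
move=> /nbhs_ballP[e /= e0 sub]; have [->|w0] := eqVneq w 0; [by right|left].
pose B := \sum_i `|w 0 i|.
have B0 : 0 <= B by apply: sumr_ge0.
pose t := e / (B + 1).
have t0 : 0 < t by rewrite divr_gt0 // ltr_wpDl.
have ww : 0 < dot w w.
  rewrite lt_def sumr_ge0 ?andbT => [|i _]; last by rewrite -expr2 sqr_ge0.
  apply: contra w0; rewrite psumr_eq0 => [/allP w0|i _]; last first.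
    by rewrite -expr2 sqr_ge0.
  apply/eqP/rowP => i; rewrite mxE; apply/eqP.
  by have := w0 i (mem_index_enum i); rewrite /= mulf_eq0 orbb.
have /sub /= : ball x e (x + t *: w).
  split=> // i j; rewrite !mxE /ball /= opprD addrA subrr sub0r normrN normrM.
  rewrite gtr0_norm // /t -mulrA gtr_pMr //; rewrite mulrC ltr_pdivrMr ?ltr_wpDl //.
  have wB : `|w 0 j| <= B by rewrite /B (bigD1 j) //= lerDl sumr_ge0.
  by rewrite mul1r ord1 (le_lt_trans wB) // ltrDl.
rewrite dotDr dotZr; apply: lt_le_trans.
by rewrite ltrDl mulr_gt0.
Qed.

End Convex.

Definition zdot k (w e : seq Z) : Z :=
  foldr (fun i => Z.add (Z.mul (nth Z0 w i) (nth Z0 e i))) Z0 (iota 0 k).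

Definition zcomb (m : seq Z) (V : seq (seq Z)) : seq Z :=
  foldr (fun t => zadd (zscale t.1 t.2)) [::] (zip m V).

(* The weights [m] combine the vectors [V] into a positive multiple of
   [sg * e_i]. *)
Definition axis_weights k (V : seq (seq Z)) (i : nat) (sg : Z) (m : seq Z) :=
  let r := zcomb m V in
  all (Z.leb Z0) m && all (fun j => if j == i then Z.ltb Z0 (Z.mul sg (nth Z0 r j))
    else Z.eqb (nth Z0 r j) Z0) (iota 0 k).

Definition positively_spans k (V : seq (seq Z)) (M : seq (seq Z * seq Z)) :=
  all (fun i => axis_weights k V i (Zpos 1) (nth ([::], [::]) M i).1 &&
                axis_weights k V i (Zneg 1) (nth ([::], [::]) M i).2) (iota 0 k).

Definition zsign (s : bool) : Z := if s then Zneg 1 else Zpos 1.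

Lemma int_of_Z_ge0 a : Z.leb Z0 a -> 0 <= int_of_Z a.
Proof. by case: a. Qed.

Lemma zdotE k w e : int_of_Z (zdot k w e) = \sum_i zvec k w 0 i * zvec k e 0 i.
Proof.
under eq_bigr do rewrite !mxE -rmorphM.
rewrite -(big_mkord xpredT (fun i => int_of_Z (Z.mul (nth Z0 w i) (nth Z0 e i)))).
rewrite /zdot unlock /reducebig /index_iota subn0; elim: (iota 0 k) => //= i s <-.
by rewrite rmorphD.
Qed.

Lemma mem_zip (S T : eqType) (s : seq S) (t : seq T) u :
  u \in zip s t -> u.1 \in s /\ u.2 \in t.
Proof.
elim: s t => [|x s IHs] [|y t] //=; rewrite !inE => /orP[/eqP->|/IHs[us ut]].
  by rewrite !eqxx.
by rewrite us ut !orbT.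
Qed.

Lemma zvecZ k a e : zvec k (zscale a e) = int_of_Z a *: zvec k e.
Proof.
apply/rowP => i; rewrite !mxE -rmorphM; congr int_of_Z; rewrite /zscale.
by elim: e (val i) => [|b e IHe] [|j] //=; case: a.
Qed.

Lemma zvec_comb k m V :
  zvec k (zcomb m V) = \sum_(t <- zip m V) int_of_Z t.1 *: zvec k t.2.
Proof.
rewrite /zcomb; elim: (zip m V) => [|t s IHs] /=; first by rewrite zvec_nil big_nil.
by rewrite zvecD zvecZ IHs big_cons.
Qed.

Lemma positively_spansP k V M (i : 'I_k) (s : bool) : positively_spans k V M ->
  exists m : seq Z, exists c : int, [/\ 0 < c, all (Z.leb Z0) m &
    \sum_(t <- zip m V) int_of_Z t.1 *: zvec k t.2
      = ((-1) ^+ s * c) *: delta_mx 0 i].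
Proof.
move=> /allP/(_ (val i)); rewrite mem_iota ltn_ord => /(_ isT)/andP[axis0 axis1].
have {axis0 axis1} [m] : exists m, axis_weights k V i (zsign s) m.
  by case: s; [exists (nth ([::], [::]) M i).2|exists (nth ([::], [::]) M i).1].
case/andP => m0 /allP r; exists m.
exists (int_of_Z (Z.mul (zsign s) (nth Z0 (zcomb m V) i))); split=> //.
  have := r (val i); rewrite mem_iota ltn_ord eqxx => /(_ isT).
  by case: Z.mul => //= p _; rewrite ltz_nat; lia.
rewrite -zvec_comb; apply/rowP => j; rewrite !mxE eqxx /=.
have := r (val j); rewrite mem_iota ltn_ord => /(_ isT) {r}.
have [-> _|ji] := eqVneq j i.
  rewrite mulr1 rmorphM mulrA (_ : _ * int_of_Z (zsign s) = 1) ?mul1r //.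
  by case: (s); rewrite ?expr1 ?mulN1r ?expr0 ?mul1r.
by rewrite -val_eqE in ji; rewrite (negPf ji) mulr0 => /Z.eqb_eq ->.
Qed.

Section Newton.
Variables (R : realType) (k : nat) (L : lpoly).

Lemma dot_lattice_point (w a : 'rV[int]_k) :
  dot (lattice_point R w) (lattice_point R a) = (\sum_i w 0 i * a 0 i)%:~R.
Proof.
by rewrite /dot rmorph_sum; apply: eq_bigr => i _; rewrite !mxE rmorphM.
Qed.

Lemma newton_polytope_nbhs0 V M : (0 < k)%N ->
    (forall v, v \in V -> (laurent_of k L)@_(zvec k v) != 0) ->
    positively_spans k V M ->
  nbhs (0 : 'rV[R]_k) (newton_polytope R (laurent_of k L)).
Proof.
move=> k0 supp span.
have convN : @convex_set R 'rV[R]_k (newton_polytope R (laurent_of k L)).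
  move=> x y t; rewrite !inE => Nx Ny B [cB sB].
  have := cB x y t; rewrite !inE; apply; [exact: Nx|exact: Ny].
apply: convex_set_nbhs0 => // i s.
have [m [c [c0 /allP m0 comb]]] := positively_spansP i s span.
pose w := [seq ((int_of_Z t.1)%:~R : R, lattice_point R (zvec k t.2))
            | t <- zip m V].
have wP t : t \in w -> 0 <= t.1 /\ newton_polytope R (laurent_of k L) t.2.
  case/mapP => -[a v] /mem_zip[/= am vV] ->; split.
    by rewrite ler0z int_of_Z_ge0 // m0.
  by move=> B [_]; apply; exists (zvec k v) => //=; apply: supp.
have w_comb : \sum_(t <- w) t.1 *: t.2 = ((-1) ^+ s * c%:~R) *: delta_mx 0 i.
  have := congr1 (lattice_point R) comb.
  rewrite /lattice_point map_mxZ map_delta_mx rmorphM rmorphXn rmorphN1 => <-.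
  rewrite (raddf_sum (map_mx intr)) /w big_map; apply: eq_bigr => t _.
  by rewrite /= map_mxZ.
have w0 : 0 < \sum_(t <- w) t.1.
  rewrite lt_def; apply/andP; split; last by rewrite big_seq sumr_ge0 // => t /wP[].
  apply/eqP => w_eq0; have /rowP/(_ i) := w_comb.
  rewrite big_seq big1 => [|t tw]; last first.
    move/eqP: w_eq0; rewrite big_seq psumr_eq0 => [/allP/(_ t tw)|u /wP[] //].
    by rewrite tw => /eqP ->; rewrite scale0r.
  rewrite !mxE !eqxx mulr1 => /esym/eqP.
  by rewrite mulf_eq0 signr_eq0 /= intr_eq0 gt_eqF.
exists ((\sum_(t <- w) t.1)^-1 * c%:~R); first by rewrite mulr_gt0 ?invr_gt0 ?ltr0z.
rewrite mulrCA -scalerA -w_comb; exact: convex_set_barycenter.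
Qed.

Lemma newton_polytope_interior (w a : 'rV[int]_k) :
    (forall b, (laurent_of k L)@_b != 0 -> \sum_i w 0 i * b 0 i <= 1) ->
    (newton_polytope R (laurent_of k L))° (lattice_point R a) ->
  \sum_i w 0 i * a 0 i <= 0.
Proof.
move=> supp int_a; set W := [set x : 'rV[R]_k | dot (lattice_point R w) x <= 1].
have NW : newton_polytope R (laurent_of k L) `<=` W.
  apply: smallest_sub; first exact: halfspace_convex.
  move=> _ [b /supp wb <-]; rewrite /W /= dot_lattice_point.
  by rewrite -(ler_int R) in wb.
have /interior_halfspace[] : W° (lattice_point R a) by apply: interiorS int_a.
  by rewrite dot_lattice_point -[1]/(1%:~R) ltr_int -ltzD1.
move=> /rowP w0; rewrite big1 // => i _.
by have /eqP := w0 i; rewrite !mxE intr_eq0 => /eqP ->; rewrite mul0r.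
Qed.

(* [W] are valid inequalities [w . x <= 1]; an interior lattice point then
   satisfies [w . x <= 0], hence vanishes since [W] positively spans. *)
Definition lpinterior (W : seq (seq Z)) (MW : seq (seq Z * seq Z))
    (V : seq (seq Z)) (MV : seq (seq Z * seq Z)) : bool :=
  [&& all (fun w => all (fun t => Z.leb (zdot k w t.1) (Zpos 1)) L) W,
      positively_spans k W MW,
      all (fun v => zeval 0 (lpcoef k v L) != 0) V & positively_spans k V MV].

Lemma lpinteriorP W MW V MV : (0 < k)%N -> lpinterior W MW V MV ->
  origin_only_interior_point R (laurent_of k L).
Proof.
move=> k0 /and4P[/allP valid spanW /allP suppV spanV] a; split=> [int_a|->].
  have Wa w : w \in W -> \sum_i zvec k w 0 i * a 0 i <= 0.
    move=> wW; apply: newton_polytope_interior int_a => b.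
    case/laurent_of_support => t tL ->; rewrite -zdotE.
    have /allP/(_ t tL) := valid w wW.
    by case: zdot => // p /Z.leb_le ?; rewrite /=; lia.
  apply/rowP => i; rewrite mxE.
  have sa (s : bool) : (-1) ^+ s * a 0 i <= 0.
    have [m [c [c0 /allP m0 /rowP comb]]] := positively_spansP i s spanW.
    have : \sum_(t <- zip m W) int_of_Z t.1 * (\sum_j zvec k t.2 0 j * a 0 j) <= 0.
      rewrite big_seq sumr_le0 // => -[x w] /mem_zip[/= xm wW].
      by rewrite mulr_ge0_le0 ?Wa // int_of_Z_ge0 // m0.
    suff -> : \sum_(t <- zip m W) int_of_Z t.1 * (\sum_j zvec k t.2 0 j * a 0 j)
        = c * ((-1) ^+ s * a 0 i) by rewrite pmulr_rle0.
    transitivity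
      (\sum_j (\sum_(t <- zip m W) int_of_Z t.1 *: zvec k t.2) 0 j * a 0 j).
      rewrite (eq_bigr _ (fun t _ => mulr_sumr _ _ _ _)) exchange_big /=.
      apply: eq_bigr => j _; rewrite summxE mulr_suml; apply: eq_bigr => t _.
      by rewrite !mxE mulrA.
    under eq_bigr do rewrite comb !mxE eqxx /=.
    rewrite (bigD1 i) //= eqxx mulr1 big1 => [|j /negPf ->].
      by rewrite addr0 mulrAC mulrC mulrA.
    by rewrite mulr0 mul0r.
  by have := sa false; have := sa true; rewrite expr0 expr1 mulN1r mul1r; lia.
rewrite /lattice_point map_mx0; apply: newton_polytope_nbhs0 k0 _ spanV.
by move=> v /suppV; rewrite mcoeff_laurent_of.
Qed.

End Newton.

(** * The Laurent polynomials *)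

Record model := Model {
  factors : seq lpoly;
  scale : Z;
  certificate : seq lpoly
}.

Record frame := Frame {
  inequalities : seq (seq Z);
  inequality_weights : seq (seq Z * seq Z);
  points : seq (seq Z);
  point_weights : seq (seq Z * seq Z)
}.

Definition cyclic_shift (p : lpoly) : lpoly :=
  lpsum [seq [:: ([:: nth Z0 t.1 2; nth Z0 t.1 0; nth Z0 t.1 1], t.2)] | t <- p].

Definition cyclic_orbit (p : lpoly) : seq lpoly :=
  [:: p; cyclic_shift p; cyclic_shift (cyclic_shift p)].

Section Data.
Local Open Scope Z_scope.

Definition recurrence_data (s : sporadic) : seq Z * seq Z * seq Z :=
  match s with
  | spA => zagier_data 7 (-8) 2
  | spB => zagier_data 9 27 3
  | spC => zagier_data 10 9 3
  | spD => zagier_data 11 (-1) 3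
  | spE => zagier_data 12 32 4
  | spF => zagier_data 17 72 6
  | sp_delta => cooper_data 7 3 81 0
  | sp_eta => cooper_data 11 5 125 0
  | sp_alpha => cooper_data 10 4 64 0
  | sp_epsilon => cooper_data 12 4 16 0
  | sp_zeta => cooper_data 9 3 (-27) 0
  | sp_gamma => cooper_data 17 5 1 0
  | sp_s7 => cooper_data 13 4 (-27) 3
  | sp_s10 => cooper_data 6 2 (-64) 4
  | sp_s18 => cooper_data 14 6 192 (-12)
  end.

(* (1+x)(1+y)(x+y)/(xy) *)
Definition model_A : model := Model
  [:: [:: ([:: 0; 0], [:: 1]); ([:: 1; 0], [:: 1])];
      [:: ([:: 0; 0], [:: 1]); ([:: 0; 1], [:: 1])];
      [:: ([:: 0; 1], [:: 1]); ([:: 1; 0], [:: 1])];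
      [:: ([:: -1; -1], [:: 1])]]
  1
  [:: [:: ([:: -2; 0], [:: -1; -1]); ([:: -2; 1], [:: -1; -3]);
          ([:: -1; -1], [:: -1; -2]); ([:: -1; 0], [:: -2; -6]);
          ([:: 0; -1], [:: -2; -5]); ([:: 0; 1], [:: 2; 5]);
          ([:: 1; 0], [:: 2; 6]); ([:: 1; 1], [:: 1; 2]);
          ([:: 2; -1], [:: 1; 3]); ([:: 2; 0], [:: 1; 1])];
      [:: ([:: -2; 0], [:: -1; -1]); ([:: -2; 2], [:: 1; 1]);
          ([:: -1; -1], [:: -2; -3]); ([:: -1; 0], [:: -1]);
          ([:: -1; 1], [:: 3; 5]); ([:: -1; 2], [:: 2; 2]);
          ([:: 0; -2], [:: -1; -1]); ([:: 0; -1], [:: -4; -4]);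
          ([:: 0; 1], [:: 4; 4]); ([:: 0; 2], [:: 1; 1]);
          ([:: 1; -2], [:: -2; -2]); ([:: 1; -1], [:: -3; -5]);
          ([:: 1; 0], [:: 1]); ([:: 1; 1], [:: 2; 3]);
          ([:: 2; -2], [:: -1; -1]); ([:: 2; 0], [:: 1; 1])]].

(* -(1+x+y)(1+x^2+y^2-x-y-xy)/(xy) = 3 - x^2/y - y^2/x - 1/(xy) *)
Definition model_B : model := Model
  [:: [:: ([:: 0; 0], [:: 1]); ([:: 0; 1], [:: 1]); ([:: 1; 0], [:: 1])];
      [:: ([:: 0; 0], [:: 1]); ([:: 0; 1], [:: -1]); ([:: 0; 2], [:: 1]);
          ([:: 1; 0], [:: -1]); ([:: 1; 1], [:: -1]); ([:: 2; 0], [:: 1])];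
      [:: ([:: -1; -1], [:: -1])]]
  2
  [:: [:: ([:: -2; 1], [:: 0; -9]); ([:: 1; 1], [:: 0; 9])];
      [:: ([:: -2; -2], [:: -2; -2]); ([:: -2; 1], [:: -1; -1]);
          ([:: -2; 4], [:: 1; 1]); ([:: -1; -1], [:: 6]);
          ([:: -1; 2], [:: -3]); ([:: 1; -2], [:: -4; -4]);
          ([:: 1; 1], [:: -1; 8]); ([:: 2; -1], [:: 6]);
          ([:: 4; -2], [:: -2; -2])]].

(* (1+x+y)(1+1/x+1/y) *)
Definition model_C : model := Model
  [:: [:: ([:: 0; 0], [:: 1]); ([:: 0; 1], [:: 1]); ([:: 1; 0], [:: 1])];
      [:: ([:: -1; 0], [:: 1]); ([:: 0; -1], [:: 1]); ([:: 0; 0], [:: 1])]]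
  1
  [:: [:: ([:: -2; 0], [:: -1; -1]); ([:: -2; 1], [:: -1; -3]);
          ([:: -1; -1], [:: -1; -2]); ([:: -1; 0], [:: -3; -6]);
          ([:: 0; -1], [:: -2; -5]); ([:: 0; 1], [:: 2; 5]);
          ([:: 1; 0], [:: 3; 6]); ([:: 1; 1], [:: 1; 2]);
          ([:: 2; -1], [:: 1; 3]); ([:: 2; 0], [:: 1; 1])];
      [:: ([:: -2; 0], [:: -1; -1]); ([:: -2; 2], [:: 1; 1]);
          ([:: -1; -1], [:: -2; -3]); ([:: -1; 0], [:: -2]);
          ([:: -1; 1], [:: 4; 5]); ([:: -1; 2], [:: 2; 2]);
          ([:: 0; -2], [:: -1; -1]); ([:: 0; -1], [:: -5; -4]);
          ([:: 0; 1], [:: 5; 4]); ([:: 0; 2], [:: 1; 1]);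
          ([:: 1; -2], [:: -2; -2]); ([:: 1; -1], [:: -4; -5]);
          ([:: 1; 0], [:: 2]); ([:: 1; 1], [:: 2; 3]);
          ([:: 2; -2], [:: -1; -1]); ([:: 2; 0], [:: 1; 1])]].

(* (1+x)(1+y)(1+x+y)/(xy) *)
Definition model_D : model := Model
  [:: [:: ([:: 0; 0], [:: 1]); ([:: 1; 0], [:: 1])];
      [:: ([:: 0; 0], [:: 1]); ([:: 0; 1], [:: 1])];
      [:: ([:: 0; 0], [:: 1]); ([:: 0; 1], [:: 1]); ([:: 1; 0], [:: 1])];
      [:: ([:: -1; -1], [:: 1])]]
  1
  [:: [:: ([:: -2; -1], [:: -2; -2]); ([:: -2; 0], [:: -4; -8]);
          ([:: -2; 1], [:: -2; -6]); ([:: -1; -1], [:: -8; -12]);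
          ([:: -1; 0], [:: -8; -14]); ([:: 0; -1], [:: -9; -15]);
          ([:: 0; 0], [:: -3; -2]); ([:: 0; 1], [:: 3; 8]);
          ([:: 1; -1], [:: -2; -2]); ([:: 1; 0], [:: 2; 5]);
          ([:: 1; 1], [:: 1; 2]); ([:: 2; -1], [:: 1; 3]);
          ([:: 2; 0], [:: 1; 1])];
      [:: ([:: -2; -2], [:: -1; -1]); ([:: -2; -1], [:: -4; -4]);
          ([:: -2; 0], [:: -4; -4]); ([:: -2; 2], [:: 1; 1]);
          ([:: -1; -2], [:: -4; -4]); ([:: -1; -1], [:: -9; -2]);
          ([:: -1; 0], [:: -2; 10]); ([:: -1; 1], [:: 5; 10]);
          ([:: -1; 2], [:: 2; 2]); ([:: 0; -2], [:: -6; -6]);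
          ([:: 0; -1], [:: -12; -10]); ([:: 0; 0], [:: -3; -2]);
          ([:: 0; 1], [:: 4; 3]); ([:: 0; 2], [:: 1; 1]);
          ([:: 1; -2], [:: -4; -4]); ([:: 1; -1], [:: -7; -12]);
          ([:: 1; 0], [:: -1; -5]); ([:: 1; 1], [:: 2; 3]);
          ([:: 2; -2], [:: -1; -1]); ([:: 2; 0], [:: 1; 1])]].

(* (y+1/y+x-1/x)(y+1/y-x+1/x) = 4 + y^2 + 1/y^2 - x^2 - 1/x^2 *)
Definition model_E : model := Model
  [:: [:: ([:: -1; 0], [:: -1]); ([:: 0; -1], [:: 1]); ([:: 0; 1], [:: 1]);
          ([:: 1; 0], [:: 1])];
      [:: ([:: -1; 0], [:: 1]); ([:: 0; -1], [:: 1]); ([:: 0; 1], [:: 1]);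
          ([:: 1; 0], [:: -1])]]
  2
  [:: [:: ([:: -4; 0], [:: -1; -1]); ([:: -2; -2], [:: 1; 3]);
          ([:: -2; 0], [:: 4]); ([:: -2; 2], [:: 1; 3]);
          ([:: 2; -2], [:: -1; -3]); ([:: 2; 0], [:: -4]);
          ([:: 2; 2], [:: -1; -3]); ([:: 4; 0], [:: 1; 1])];
      [:: ([:: -2; -2], [:: 1; 3]); ([:: -2; 2], [:: -1; -3]);
          ([:: 0; -4], [:: -1; -1]); ([:: 0; -2], [:: -4]);
          ([:: 0; 2], [:: 4]); ([:: 0; 4], [:: 1; 1]);
          ([:: 2; -2], [:: 1; 3]); ([:: 2; 2], [:: -1; -3])]].

(* 4 + x + 1/x + y + 1/y *)
Definition reflexive_model_E : model := Model
  [:: [:: ([:: -1; 0], [:: 1]); ([:: 0; -1], [:: 1]); ([:: 0; 0], [:: 4]);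
          ([:: 0; 1], [:: 1]); ([:: 1; 0], [:: 1])]]
  1
  [:: [:: ([:: -2; 0], [:: -1; -1]); ([:: -1; -1], [:: -1; -3]);
          ([:: -1; 0], [:: -4]); ([:: -1; 1], [:: -1; -3]);
          ([:: 1; -1], [:: 1; 3]); ([:: 1; 0], [:: 4]);
          ([:: 1; 1], [:: 1; 3]); ([:: 2; 0], [:: 1; 1])];
      [:: ([:: -1; -1], [:: -1; -3]); ([:: -1; 1], [:: 1; 3]);
          ([:: 0; -2], [:: -1; -1]); ([:: 0; -1], [:: -4]);
          ([:: 0; 1], [:: 4]); ([:: 0; 2], [:: 1; 1]);
          ([:: 1; -1], [:: -1; -3]); ([:: 1; 1], [:: 1; 3])]].

(* -(1+x-y^2+xy^2)(1-x-y-xy)(1-x+y+xy)/(x^2 y^2) *)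
Definition model_F : model := Model
  [:: [:: ([:: 0; 0], [:: 1]); ([:: 0; 2], [:: -1]); ([:: 1; 0], [:: 1]);
          ([:: 1; 2], [:: 1])];
      [:: ([:: 0; 0], [:: 1]); ([:: 0; 1], [:: -1]); ([:: 1; 0], [:: -1]);
          ([:: 1; 1], [:: -1])];
      [:: ([:: 0; 0], [:: 1]); ([:: 0; 1], [:: 1]); ([:: 1; 0], [:: -1]);
          ([:: 1; 1], [:: 1])];
      [:: ([:: -2; -2], [:: -1])]]
  2
  [:: [:: ([:: -4; -2], [:: 2; 2]); ([:: -4; 0], [:: -4; -8]);
          ([:: -4; 2], [:: 2; 6]); ([:: -3; -2], [:: -2; -4]);
          ([:: -3; 2], [:: 2; 8]); ([:: -2; -4], [:: -4; -4]);
          ([:: -2; 0], [:: -16; 24]); ([:: -2; 2], [:: 8; -8]);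
          ([:: -2; 4], [:: -4; -4]); ([:: -1; -4], [:: 4; 4]);
          ([:: -1; -2], [:: 8; 4]); ([:: -1; 2], [:: 0; -12]);
          ([:: -1; 4], [:: -4; -4]); ([:: 0; -4], [:: 4; 4]);
          ([:: 0; -2], [:: 30; -2]); ([:: 0; 0], [:: 20; -8]);
          ([:: 0; 2], [:: 22; 2]); ([:: 0; 4], [:: 4; 4]);
          ([:: 1; -4], [:: -4; -4]); ([:: 1; -2], [:: -6]);
          ([:: 1; 2], [:: -2; 4]); ([:: 1; 4], [:: 4; 4]);
          ([:: 2; 0], [:: 0; -8])];
      [:: ([:: -4; -4], [:: -1; -1]); ([:: -4; -2], [:: 4; 4]);
          ([:: -4; 0], [:: -4; -4]); ([:: -4; 4], [:: 1; 1]);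
          ([:: -3; -4], [:: 2; 2]); ([:: -3; -2], [:: -4; -3]);
          ([:: -3; 2], [:: 0; -1]); ([:: -3; 4], [:: 2; 2]);
          ([:: -2; -4], [:: 1; 5]); ([:: -2; -2], [:: 6; -14]);
          ([:: -2; 0], [:: -20; 4]); ([:: -2; 2], [:: -2; 10]);
          ([:: -2; 4], [:: -1; -5]); ([:: -1; -4], [:: -4; -6]);
          ([:: -1; -2], [:: -4; 6]); ([:: -1; 2], [:: -4; 6]);
          ([:: -1; 4], [:: -4; -6]); ([:: 0; -4], [:: 1; 1]);
          ([:: 0; -2], [:: -6; -2]); ([:: 0; 2], [:: 6; 2]);
          ([:: 0; 4], [:: -1; -1]); ([:: 1; -4], [:: 2]);
          ([:: 1; -2], [:: 4; 1]); ([:: 1; 2], [:: 8; -1]);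
          ([:: 1; 4], [:: 2]); ([:: 2; -4], [:: -1; -1]);
          ([:: 2; 4], [:: 1; 1])]].

(* 8 - (1+x)(1+y)(x+y)/(xy) *)
Definition reflexive_model_F : model := Model
  [:: [:: ([:: -1; 0], [:: -1]); ([:: -1; 1], [:: -1]); ([:: 0; -1], [:: -1]);
          ([:: 0; 0], [:: 6]); ([:: 0; 1], [:: -1]); ([:: 1; -1], [:: -1]);
          ([:: 1; 0], [:: -1])]]
  1
  [:: [:: ([:: -2; 0], [:: -1; -1]); ([:: -2; 1], [:: -1; 2]);
          ([:: -1; -1], [:: -1; -7]); ([:: -1; 0], [:: 6; -6]);
          ([:: 0; -1], [:: -2; -5]); ([:: 0; 1], [:: 2; 5]);
          ([:: 1; 0], [:: -6; 6]); ([:: 1; 1], [:: 1; 7]);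
          ([:: 2; -1], [:: 1; -2]); ([:: 2; 0], [:: 1; 1])];
      [:: ([:: -2; 0], [:: 4; 4]); ([:: -2; 1], [:: 5; 5]);
          ([:: -2; 2], [:: 1; 1]); ([:: -1; -1], [:: 3; -3]);
          ([:: -1; 0], [:: -23; -5]); ([:: -1; 2], [:: 2; 2]);
          ([:: 0; -2], [:: -1; -1]); ([:: 0; -1], [:: 9; -9]);
          ([:: 0; 1], [:: -9; 9]); ([:: 0; 2], [:: 1; 1]);
          ([:: 1; -2], [:: -2; -2]); ([:: 1; 0], [:: 23; 5]);
          ([:: 1; 1], [:: -3; 3]); ([:: 2; -2], [:: -1; -1]);
          ([:: 2; -1], [:: -5; -5]); ([:: 2; 0], [:: -4; -4])]].

(* (1-z(1+x+y))(1+x^2+y^2-x-y-xy-z)/(xyz) *)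
Definition model_delta : model := Model
  [:: [:: ([:: 0; 0; 0], [:: 1]); ([:: 0; 0; 1], [:: -1]);
          ([:: 0; 1; 1], [:: -1]); ([:: 1; 0; 1], [:: -1])];
      [:: ([:: 0; 0; 0], [:: 1]); ([:: 0; 0; 1], [:: -1]);
          ([:: 0; 1; 0], [:: -1]); ([:: 0; 2; 0], [:: 1]);
          ([:: 1; 0; 0], [:: -1]); ([:: 1; 1; 0], [:: -1]);
          ([:: 2; 0; 0], [:: 1])];
      [:: ([:: -1; -1; -1], [:: 1])]]
  12
  [:: [:: ([:: -2; -1; -2], [:: -6; -12; -6]);
          ([:: -2; -1; -1], [:: 12; -10; 42]);
          ([:: -2; -1; 1], [:: -12; 18; 54]);
          ([:: -2; -1; 2], [:: 6; 4; -90]); ([:: -2; 0; -2], [:: 18; 36; 18]);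
          ([:: -2; 0; -1], [:: -16; 116; -84]);
          ([:: -2; 0; 2], [:: -2; -92; -90]);
          ([:: -2; 1; -2], [:: -18; -36; -18]);
          ([:: -2; 1; -1], [:: 4; -104; -372]);
          ([:: -2; 1; 0], [:: -36; -678; 78]);
          ([:: -2; 1; 1], [:: 20; 452; 432]);
          ([:: -2; 2; -2], [:: 12; 24; 12]);
          ([:: -2; 2; -1], [:: 2; 100; 186]);
          ([:: -2; 2; 1], [:: 38; 728; 426]);
          ([:: -1; -1; -1], [:: 24; 74; 246]);
          ([:: -1; -1; 0], [:: 0; 42; -150]);
          ([:: -1; -1; 1], [:: -12; -60; -180]);
          ([:: -1; -1; 2], [:: 6; 4; -90]);
          ([:: -1; 0; -1], [:: 46; 142; -524]);
          ([:: -1; 0; 0], [:: -96; -288; 384]);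
          ([:: -1; 0; 1], [:: 2; -286; -244]);
          ([:: -1; 1; -2], [:: -18; -36; -18]);
          ([:: -1; 1; -1], [:: -68; -404; 668]);
          ([:: -1; 1; 1], [:: 52; 592; 596]);
          ([:: -1; 2; -1], [:: 66; 536; 790]);
          ([:: -1; 2; 0], [:: 36; 108; 180]);
          ([:: 0; -1; -1], [:: -12; -80; -232]);
          ([:: 0; -1; 1], [:: -12; -64; -152]);
          ([:: 0; 0; -2], [:: 18; 36; 18]);
          ([:: 0; 0; -1], [:: -82; -254; 216]);
          ([:: 0; 0; 0], [:: -36; -72; 288]); ([:: 0; 0; 1], [:: 32; 88]);
          ([:: 0; 1; -1], [:: -60; -488; -812]);
          ([:: 1; -2; 0], [:: -6; -12; -6]);
          ([:: 1; -1; -2], [:: -6; -12; -6]);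
          ([:: 1; -1; -1], [:: 18; 70; 280]);
          ([:: 1; -1; 1], [:: -6; 14; 76]);
          ([:: 1; 0; -1], [:: 60; 308; -424]); ([:: 1; 1; 0], [:: 0; 54; 54]);
          ([:: 2; -1; -1], [:: 6; -6; 20])];
      [:: ([:: -2; -2; -1], [:: 24; 48; 24]);
          ([:: -2; -2; 0], [:: -48; -144; -96]);
          ([:: -2; -2; 1], [:: 24; 96; 72]);
          ([:: -2; -1; -1], [:: -32; -152; -120]);
          ([:: -2; -1; 1], [:: 24; 96; 72]);
          ([:: -2; -1; 2], [:: 8; 104; 96]);
          ([:: -2; 0; -1], [:: 40; 256; 216]);
          ([:: -2; 0; 2], [:: 8; 104; 96]);
          ([:: -2; 1; -1], [:: -16; -223; -207]);
          ([:: -2; 1; 0], [:: -30; -348; -318]);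
          ([:: -2; 1; 1], [:: 4; 199; 195]);
          ([:: -2; 2; -1], [:: 8; 119; 111]);
          ([:: -2; 2; 1], [:: 4; 199; 195]);
          ([:: -2; 3; -1], [:: 0; -15; -15]); ([:: -2; 4; 0], [:: 6; 12; 6]);
          ([:: -1; -2; -2], [:: 6; 12; 6]);
          ([:: -1; -2; -1], [:: -36; -54; -18]);
          ([:: -1; -2; 1], [:: 36; 102; 66]);
          ([:: -1; -2; 2], [:: -6; -12; -6]);
          ([:: -1; -1; -1], [:: -40; 142; 354]);
          ([:: -1; -1; 0], [:: 120; 246; 246]);
          ([:: -1; -1; 1], [:: -36; -132; -300]);
          ([:: -1; -1; 2], [:: 10; 188; 90]);
          ([:: -1; 0; -1], [:: 12; -8; -112]);
          ([:: -1; 0; 0], [:: 0; -96; -384]);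
          ([:: -1; 0; 1], [:: -12; 152; -272]);
          ([:: -1; 1; -2], [:: 6; 12; 6]);
          ([:: -1; 1; -1], [:: -26; -93; 265]);
          ([:: -1; 1; 1], [:: 10; 231; 277]);
          ([:: -1; 2; -1], [:: -6; 87; 413]);
          ([:: -1; 2; 0], [:: 6; 54; 120]);
          ([:: 0; -2; -2], [:: -18; -36; -18]);
          ([:: 0; -2; -1], [:: 48; 60; 12]);
          ([:: 0; -2; 2], [:: -6; -12; -6]);
          ([:: 0; -1; -1], [:: -14; -206; -524]);
          ([:: 0; -1; 1], [:: -10; -34; -244]);
          ([:: 0; 0; -2], [:: -18; -36; -18]);
          ([:: 0; 0; -1], [:: 50; 166; 216]);
          ([:: 0; 0; 0], [:: -36; -72; 288]); ([:: 0; 0; 1], [:: 32; 88]);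
          ([:: 0; 1; -1], [:: -12; -55; -427]);
          ([:: 1; -2; -2], [:: 18; 36; 18]);
          ([:: 1; -2; -1], [:: 12; 36; 24]);
          ([:: 1; -2; 0], [:: -60; -150; -90]);
          ([:: 1; -2; 1], [:: 12; 36; 24]); ([:: 1; -1; -2], [:: 18; 36; 18]);
          ([:: 1; -1; -1], [:: -12; 48; 584]);
          ([:: 1; -1; 1], [:: 20; -112; 188]);
          ([:: 1; 0; -1], [:: 36; -92; -800]);
          ([:: 1; 1; 0], [:: -6; 42; 48]);
          ([:: 2; -2; -2], [:: -12; -24; -12]);
          ([:: 2; -2; -1], [:: -18; -42; -24]);
          ([:: 2; -2; 1], [:: 18; 42; 24]);
          ([:: 2; -1; -1], [:: -42; -70; 4]);
          ([:: 2; -1; 0], [:: 24; 0; -60]); ([:: 3; -2; -1], [:: 24; 48; 24]);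
          ([:: 4; -2; 0], [:: -12; -24; -12])];
      [:: ([:: -2; -2; -2], [:: -12; -24; -12]);
          ([:: -2; -2; -1], [:: 48; 96; 48]);
          ([:: -2; -2; 0], [:: -48; -96; -48]);
          ([:: -2; -2; 2], [:: 12; 24; 12]);
          ([:: -2; -1; -2], [:: 30; 60; 30]);
          ([:: -2; -1; -1], [:: -54; -84; -30]);
          ([:: -2; -1; 1], [:: -6; -36; -30]);
          ([:: -2; -1; 2], [:: 30; 60; 30]);
          ([:: -2; 0; -2], [:: -54; -108; -54]);
          ([:: -2; 0; -1], [:: 68; 176; 108]);
          ([:: -2; 0; 2], [:: 10; -68; -78]);
          ([:: -2; 1; -2], [:: 42; 84; 42]);
          ([:: -2; 1; -1], [:: 18; 345; 327]);
          ([:: -2; 1; 0], [:: -84; -1242; -1158]);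
          ([:: -2; 1; 1], [:: 18; 609; 591]);
          ([:: -2; 2; -2], [:: -24; -48; -24]);
          ([:: -2; 2; -1], [:: -14; -146; -132]);
          ([:: -2; 2; 1], [:: 26; 698; 672]);
          ([:: -2; 3; -1], [:: 18; 51; 33]);
          ([:: -1; -2; -2], [:: 18; 36; 18]);
          ([:: -1; -2; -1], [:: -42; -84; -42]);
          ([:: -1; -2; 1], [:: 6; 12; 6]); ([:: -1; -2; 2], [:: 18; 36; 18]);
          ([:: -1; -1; -1], [:: -120; -344; -684]);
          ([:: -1; -1; 0], [:: 144; 504; 1152]);
          ([:: -1; -1; 1], [:: 0; -168; -588]);
          ([:: -1; -1; 2], [:: 24; 56; 120]);
          ([:: -1; 0; -1], [:: 54; -150; 396]);
          ([:: -1; 0; 0], [:: 24; 336; -192]);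
          ([:: -1; 0; 1], [:: 6; -342; -228]);
          ([:: -1; 1; -2], [:: 36; 72; 36]);
          ([:: -1; 1; -1], [:: -76; -17; -113]);
          ([:: -1; 1; 1], [:: 4; 209; 317]);
          ([:: -1; 2; -1], [:: -12; -138; -446]);
          ([:: 0; -2; -2], [:: -18; -36; -18]);
          ([:: 0; -2; -1], [:: 36; 72; 36]); ([:: 0; -2; 2], [:: 6; 12; 6]);
          ([:: 0; -1; -1], [:: 42; 174; 492]);
          ([:: 0; -1; 1], [:: -6; -90; -228]);
          ([:: 0; 0; -2], [:: -36; -72; -36]);
          ([:: 0; 0; -1], [:: 136; 616; -788]);
          ([:: 0; 0; 0], [:: -132; -360; 672]);
          ([:: 0; 0; 1], [:: 32; 56; -88]);
          ([:: 0; 1; -1], [:: -42; -343; 83]);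
          ([:: 0; 1; 0], [:: 0; -12; -96]); ([:: 1; -2; -2], [:: 6; 12; 6]);
          ([:: 1; -2; -1], [:: 12; 24; 12]);
          ([:: 1; -2; 0], [:: -24; -48; -24]);
          ([:: 1; -2; 1], [:: -12; -24; -12]);
          ([:: 1; -1; -2], [:: 12; 24; 12]);
          ([:: 1; -1; -1], [:: -30; -106; -272]);
          ([:: 1; -1; 1], [:: -18; -14; -148]);
          ([:: 1; 0; -1], [:: -24; -268; 428]);
          ([:: 1; 0; 0], [:: 0; -12; -96]);
          ([:: 1; 1; 0], [:: 126; 1209; 1083]);
          ([:: 2; -2; -1], [:: -6; -12; -6]);
          ([:: 2; -2; 1], [:: -6; -12; -6]);
          ([:: 2; -1; -1], [:: -12; -6; -26])]].

(* (zx+xy-yz-x-1)(xy+yz-zx-y-1)(yz+zx-xy-z-1)/(xyz); the certificate is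
   chosen invariant under the cyclic symmetry of this polynomial *)
Definition model_eta : model := Model
  [:: [:: ([:: 0; 0; 0], [:: -1]); ([:: 0; 1; 1], [:: -1]);
          ([:: 1; 0; 0], [:: -1]); ([:: 1; 0; 1], [:: 1]);
          ([:: 1; 1; 0], [:: 1])];
      [:: ([:: 0; 0; 0], [:: -1]); ([:: 0; 1; 0], [:: -1]);
          ([:: 0; 1; 1], [:: 1]); ([:: 1; 0; 1], [:: -1]);
          ([:: 1; 1; 0], [:: 1])];
      [:: ([:: 0; 0; 0], [:: -1]); ([:: 0; 0; 1], [:: -1]);
          ([:: 0; 1; 1], [:: 1]); ([:: 1; 0; 1], [:: 1]);
          ([:: 1; 1; 0], [:: -1])];
      [:: ([:: -1; -1; -1], [:: 1])]]
  4536
  (cyclic_orbit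
    [:: ([:: -2; -2; -2], [:: -1512; -3024; -1512]);
        ([:: -2; -2; -1], [:: -7560; 37223; -27691]);
        ([:: -2; -1; -1], [:: -4536; 41759; -26179]);
        ([:: -2; 0; -2], [:: -4536; -9072; -4536]);
        ([:: -2; 0; 1], [:: -202635; 118313; 117356]);
        ([:: -2; 0; 2], [:: -420390; 303512; 162698]);
        ([:: -2; 1; 0], [:: 212463; -82403; -84470]);
        ([:: -2; 1; 1], [:: 5292; 67085; -3877]);
        ([:: -2; 1; 2], [:: 420390; -317120; -171770]);
        ([:: -2; 2; 0], [:: 433998; -158758; -171964]);
        ([:: -2; 2; 1], [:: -424926; 172366; 176500]);
        ([:: -2; 2; 4], [:: 0; 4536; 4536]);
        ([:: -2; 3; 3], [:: 2268; 3402; -1134]);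
        ([:: -2; 4; 2], [:: -4536; -9072; -4536]);
        ([:: -1; -2; -2], [:: -55367; -38260; 17107]);
        ([:: -1; -2; -1], [:: -53855; 17107; -1512]);
        ([:: -1; -1; -2], [:: -58391; 8035; -6048]);
        ([:: -1; -1; -1], [:: 7560; 3024; -12096]);
        ([:: -1; -1; 0], [:: 0; -89950; -40936]);
        ([:: -1; -1; 1], [:: 818100; -435074; -419528]);
        ([:: -1; -1; 2], [:: 845316; -585100; -304228]);
        ([:: -1; 0; -1], [:: 22680; 99022; 4648]);
        ([:: -1; 0; 0], [:: -22676; -83562; 33662]);
        ([:: -1; 0; 1], [:: -241189; -74070; 220881]);
        ([:: -1; 0; 2], [:: -406030; 365142; 242476]);
        ([:: -1; 1; -1], [:: -819612; 408614; 358292]);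
        ([:: -1; 1; 0], [:: 407477; -224027; -150078]);
        ([:: -1; 1; 1], [:: 13039; 206561; -92165]);
        ([:: -1; 1; 2], [:: -18896; -244558; -18368]);
        ([:: -1; 2; -1], [:: -849852; 362120; 351488]);
        ([:: -1; 2; 0], [:: 448358; -69912; -105794]);
        ([:: -1; 2; 1], [:: -41576; 25668; 103505]);
        ([:: -1; 2; 2], [:: 43462; 32763; 64193]);
        ([:: -1; 2; 3], [:: 84847; 204577; 58426]);
        ([:: -1; 3; 2], [:: -135113; -248680; 51030]);
        ([:: -1; 4; 1], [:: 13608; 13608]);
        ([:: 0; -2; -2], [:: -53855; -35236; 18619]);
        ([:: 0; -2; 1], [:: -617733; 309201; 295746]);
        ([:: 0; -2; 2], [:: -424926; 284612; 143798]);
        ([:: 0; -1; -1], [:: 269275; -88559; -3024]);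
        ([:: 0; -1; 0], [:: 198099; -230370; -63849]);
        ([:: 0; -1; 1], [:: 328556; -178021; -180173]);
        ([:: 0; -1; 2], [:: -420390; 272520; 82164]);
        ([:: 0; 0; -1], [:: -196587; 215254; -7613]);
        ([:: 0; 0; 0], [:: -75019; 40320; 34699]);
        ([:: 0; 0; 2], [:: -54802; 119161; 6737]);
        ([:: 0; 0; 4], [:: -4536; -13608; -9072]);
        ([:: 0; 1; -2], [:: 616221; -312225; -297258]);
        ([:: 0; 1; -1], [:: -529612; 388179; -51882]);
        ([:: 0; 1; 1], [:: -105820; 550458; -126068]);
        ([:: 0; 1; 2], [:: -51018; -172627; -113266]);
        ([:: 0; 1; 3], [:: -200312; -297855; 146570]);
        ([:: 0; 2; -2], [:: 427194; -175390; -181792]);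
        ([:: 0; 2; -1], [:: 427194; -201090; -261570]);
        ([:: 0; 2; 0], [:: -54802; -84171; -145841]);
        ([:: 0; 2; 1], [:: -73698; 56775; -45825]);
        ([:: 0; 2; 2], [:: -41194; -92479; -226773]);
        ([:: 0; 2; 3], [:: 50518; -76772; -397952]);
        ([:: 0; 2; 4], [:: 9072; 0; -9072]);
        ([:: 0; 3; 1], [:: 278164; 352041; -363214]);
        ([:: 0; 3; 2], [:: 41698; 154394; 179796]);
        ([:: 0; 3; 3], [:: 3024; 8694; 6426]);
        ([:: 0; 4; 0], [:: -11340; -4536; 6804]);
        ([:: 0; 4; 2], [:: -6804; 4536; 11340]);
        ([:: 1; -2; 0], [:: -410184; 207142; 196534]);
        ([:: 1; -2; 1], [:: -186202; 120086; 23418]);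
        ([:: 1; -2; 2], [:: 420390; -293684; -148334]);
        ([:: 1; -1; -1], [:: 1512; 21924; 32508]);
        ([:: 1; -1; 0], [:: -258758; 29407; 207549]);
        ([:: 1; -1; 1], [:: -374473; 21280; 44237]);
        ([:: 1; -1; 2], [:: 0; 71430; 11631]);
        ([:: 1; -1; 4], [:: 4536; 9072; 4536]);
        ([:: 1; 0; -2], [:: 414342; -201094; -194644]);
        ([:: 1; 0; -1], [:: 156340; 55455; -105847]);
        ([:: 1; 0; 1], [:: 98831; 156987; 30705]);
        ([:: 1; 0; 2], [:: -5670; -66313; 49073]);
        ([:: 1; 0; 3], [:: 112063; 79670; -222006]);
        ([:: 1; 1; -2], [:: 292022; -160348; -24552]);
        ([:: 1; 1; -1], [:: 481049; -21482; -95752]);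
        ([:: 1; 1; 0], [:: -140407; -245085; 103505]);
        ([:: 1; 1; 1], [:: 3776; -2622; 1870]);
        ([:: 1; 1; 2], [:: 537611; 886124; 653407]);
        ([:: 1; 1; 3], [:: -93980; -76362; 220172]);
        ([:: 1; 2; -2], [:: -422658; 184462; 186328]);
        ([:: 1; 2; -1], [:: -11340; -11340; 42336]);
        ([:: 1; 2; 0], [:: 5670; -432917; -42095]);
        ([:: 1; 2; 1], [:: -64435; -740841; -230760]);
        ([:: 1; 2; 2], [:: -82766; 36518; 114748]);
        ([:: 1; 2; 3], [:: -8820; -2772; -12600]);
        ([:: 1; 3; 0], [:: -129443; -69341; 343936]);
        ([:: 1; 3; 1], [:: -92720; -78882; 218408]);
        ([:: 1; 3; 2], [:: -5166; -32760; -10458]);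
        ([:: 1; 4; -1], [:: 4536; 4536]);
        ([:: 2; -2; 0], [:: -369937; 215162; 164307]);
        ([:: 2; -2; 1], [:: 576730; -318733; -264275]);
        ([:: 2; -1; -1], [:: -103174; 57650; 27972]);
        ([:: 2; -1; 0], [:: -159742; 83436; 140812]);
        ([:: 2; -1; 1], [:: 17010; -66512; -103505]);
        ([:: 2; -1; 3], [:: -4536; -3402; 10206]);
        ([:: 2; 0; -2], [:: 478781; -249376; -162417]);
        ([:: 2; 0; -1], [:: 261782; -152235; -9509]);
        ([:: 2; 0; 0], [:: 20782; -150921; 134675]);
        ([:: 2; 0; 1], [:: 203332; 92110; -63039]);
        ([:: 2; 0; 2], [:: -165910; -648237; -519351]);
        ([:: 2; 0; 3], [:: 46864; 162206; 183450]);
        ([:: 2; 0; 4], [:: -9072; 0; 9072]);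
        ([:: 2; 1; -2], [:: -682172; 409826; 243388]);
        ([:: 2; 1; 0], [:: -218444; 114365; 113266]);
        ([:: 2; 1; 1], [:: -193126; -261247; -66180]);
        ([:: 2; 1; 2], [:: 9954; -230796; -504356]);
        ([:: 2; 1; 3], [:: 9198; 3150; 11844]);
        ([:: 2; 2; -1], [:: -11340; 60090; 23727]);
        ([:: 2; 2; 0], [:: 234320; 773781; 416117]);
        ([:: 2; 2; 1], [:: -17514; 316964; 391498]);
        ([:: 2; 2; 2], [:: 9450; 27972; 23058]);
        ([:: 2; 3; -1], [:: -15876; -37422; -30618]);
        ([:: 2; 3; 0], [:: 41950; -102728; -416348]);
        ([:: 2; 3; 1], [:: -7308; -2394; -14490]);
        ([:: 2; 4; -2], [:: -2268; -4536; -2268]);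
        ([:: 2; 4; 0], [:: 4536; -9072; -13608]);
        ([:: 3; -2; 3], [:: 5670; 13608; 7938]);
        ([:: 3; -1; 2], [:: -3402; 73507; 29213]);
        ([:: 3; 0; 2], [:: -55810; 123258; 178060]);
        ([:: 3; 1; 0], [:: 9072; 76348; -26945]);
        ([:: 3; 1; 1], [:: 104312; 6574; -94714]);
        ([:: 3; 1; 2], [:: -7686; -2772; -13734]);
        ([:: 3; 2; -1], [:: -11340; -163463; -10206]);
        ([:: 3; 2; 0], [:: -62110; -166120; -106026]);
        ([:: 3; 2; 1], [:: -6300; -32760; -9324]);
        ([:: 3; 3; -1], [:: 13608; 36288; 22680]);
        ([:: 3; 3; 0], [:: 13986; 35532; 23058]);
        ([:: 4; -2; 2], [:: 3402; 9072; 5670]);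
        ([:: 4; -2; 3], [:: -3402; -9072; -5670]);
        ([:: 4; -1; 1], [:: -11340; -24948; -2268]);
        ([:: 4; -1; 2], [:: 11340; 27216; 15876]);
        ([:: 4; -1; 3], [:: -3402; -9072; -5670]);
        ([:: 4; 0; 0], [:: 12474; 29484; 12474]);
        ([:: 4; 0; 1], [:: -3402; -27216; -5670]);
        ([:: 4; 0; 2], [:: -3402; 0; 3402]);
        ([:: 4; 1; -1], [:: -4536; -13608; -15876]);
        ([:: 4; 1; 0], [:: -13608; -9072; -13608]);
        ([:: 4; 1; 1], [:: 7938; 18144; 10206]);
        ([:: 4; 2; -1], [:: 13608; 27216; 13608]);
        ([:: 4; 2; 0], [:: 1134; -4536; -5670]);
        ([:: 4; 3; -2], [:: -4536; -9072; -4536]);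
        ([:: 4; 3; -1], [:: -4536; -9072; -4536]);
        ([:: 4; 4; -2], [:: 2268; 4536; 2268])]).

(* (1+x+y+z)(1+1/x+1/y+1/z) *)
Definition model_alpha : model := Model
  [:: [:: ([:: 0; 0; 0], [:: 1]); ([:: 0; 0; 1], [:: 1]);
          ([:: 0; 1; 0], [:: 1]); ([:: 1; 0; 0], [:: 1])];
      [:: ([:: -1; 0; 0], [:: 1]); ([:: 0; -1; 0], [:: 1]);
          ([:: 0; 0; -1], [:: 1]); ([:: 0; 0; 0], [:: 1])]]
  1
  [:: [:: ([:: -2; 0; 0], [:: -1; -2; -1]); ([:: -2; 0; 1], [:: -1; -2; -3]);
          ([:: -2; 1; 0], [:: -1; -4; -3]); ([:: -1; -1; 0], [:: -1; -3; -2]);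
          ([:: -1; -1; 1], [:: -4; -5; -9]);
          ([:: -1; 0; -1], [:: -1; -5; -2]);
          ([:: -1; 0; 0], [:: -4; -14; -6]); ([:: -1; 0; 1], [:: 0; 2]);
          ([:: -1; 1; -1], [:: -1; -6; -11]);
          ([:: 0; -2; 1], [:: -3; -4; -1]); ([:: 0; -1; 0], [:: -5; -8; -5]);
          ([:: 0; 0; -1], [:: -2; -6; -4]); ([:: 0; 0; 1], [:: 2; 7; 5]);
          ([:: 0; 1; -1], [:: -3; -1]); ([:: 0; 1; 0], [:: 2; 7; 5]);
          ([:: 1; -1; 1], [:: 1; 4; 9]); ([:: 1; 0; 0], [:: 4; 14; 6]);
          ([:: 1; 0; 1], [:: 1; 3; 2]); ([:: 1; 1; -1], [:: 1; 6; 11]);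
          ([:: 1; 1; 0], [:: 1; 3; 2]); ([:: 2; -1; 0], [:: 1; 4; 3]);
          ([:: 2; 0; -1], [:: 1; 4; 3]); ([:: 2; 0; 0], [:: 1; 2; 1])];
      [:: ([:: -2; 0; 0], [:: -1; -2; -1]); ([:: -2; 1; 1], [:: 1; 4; 3]);
          ([:: -2; 2; 0], [:: 1; 2; 1]); ([:: -1; -1; 0], [:: -2; -5; -3]);
          ([:: -1; -1; 1], [:: -1; -5; -8]);
          ([:: -1; 0; -1], [:: -1; -5; -4]); ([:: -1; 0; 0], [:: -2; -6]);
          ([:: -1; 0; 1], [:: 1; 13; 6]); ([:: -1; 1; -1], [:: 0; -2; -2]);
          ([:: -1; 1; 0], [:: 5; 14; 5]); ([:: -1; 1; 1], [:: 2; 7; 5]);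
          ([:: -1; 2; -1], [:: 1; 3; 2]); ([:: -1; 2; 0], [:: 2; 4; 2]);
          ([:: 0; -2; 0], [:: -1; -2; -1]); ([:: 0; -2; 1], [:: -1; -6; -3]);
          ([:: 0; -1; -1], [:: -1; -1; -2]);
          ([:: 0; -1; 0], [:: -6; -14; -4]); ([:: 0; -1; 1], [:: 0; -1; 1]);
          ([:: 0; 0; -1], [:: -4; -13; -3]); ([:: 0; 0; 1], [:: 4; 13; 3]);
          ([:: 0; 1; -1], [:: 0; -1; -1]); ([:: 0; 1; 0], [:: 6; 14; 4]);
          ([:: 0; 1; 1], [:: 1; 3; 2]); ([:: 0; 2; -1], [:: 1; 4; 3]);
          ([:: 0; 2; 0], [:: 1; 2; 1]); ([:: 1; -2; 0], [:: -2; -4; -2]);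
          ([:: 1; -2; 1], [:: -1; -3; -2]); ([:: 1; -1; -1], [:: -2; -8; -6]);
          ([:: 1; -1; 0], [:: -5; -14; -5]);
          ([:: 1; 0; -1], [:: -1; -13; -4]); ([:: 1; 0; 0], [:: 2; 4]);
          ([:: 1; 0; 1], [:: 1; 3; 2]); ([:: 1; 1; -1], [:: 1; 6; 11]);
          ([:: 1; 1; 0], [:: 2; 5; 3]); ([:: 2; -2; 0], [:: -1; -2; -1]);
          ([:: 2; -1; -1], [:: -1; -4; -3]); ([:: 2; 0; 0], [:: 1; 2; 1])];
      [:: ([:: -2; 0; 0], [:: 1; 0; -1]); ([:: -2; 0; 1], [:: 2; 2]);
          ([:: -2; 0; 2], [:: 1; 2; 1]); ([:: -2; 1; 1], [:: 1; 4; 3]);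
          ([:: -1; -1; 0], [:: -2; -4; -2]); ([:: -1; -1; 2], [:: 2; 4; 2]);
          ([:: -1; 0; -1], [:: 0; -5; -3]); ([:: -1; 0; 0], [:: 1; -5]);
          ([:: -1; 0; 1], [:: 8; 14; 4]); ([:: -1; 0; 2], [:: 2; 4; 2]);
          ([:: -1; 1; -1], [:: -2; -6; -10]); ([:: -1; 1; 0], [:: 3; 1; -2]);
          ([:: -1; 1; 1], [:: 3; 9; 6]); ([:: -1; 2; -1], [:: -1; -2; -1]);
          ([:: -1; 2; 0], [:: 1; 2; 1]); ([:: 0; -2; 0], [:: -3; -4; -1]);
          ([:: 0; -2; 1], [:: -2; -2]); ([:: 0; -2; 2], [:: 1; 2; 1]);
          ([:: 0; -1; -1], [:: -4; -5; -3]); ([:: 0; -1; 0], [:: -6; -2; 2]);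
          ([:: 0; -1; 1], [:: 5; 15; 4]); ([:: 0; -1; 2], [:: 2; 4; 2]);
          ([:: 0; 0; -2], [:: -1; -2; -1]); ([:: 0; 0; -1], [:: -8; -14; -2]);
          ([:: 0; 0; 1], [:: 8; 14; 2]); ([:: 0; 0; 2], [:: 1; 2; 1]);
          ([:: 0; 1; -2], [:: -2; -4; -2]); ([:: 0; 1; -1], [:: -7; -15; -4]);
          ([:: 0; 1; 0], [:: 3; 3; -2]); ([:: 0; 1; 1], [:: 2; 5; 3]);
          ([:: 0; 2; -2], [:: -1; -2; -1]); ([:: 0; 2; 0], [:: 1; 2; 1]);
          ([:: 1; -2; 1], [:: 1; 2; 1]); ([:: 1; -1; -1], [:: -2; -8; -6]);
          ([:: 1; -1; 1], [:: 4; 6; 8]); ([:: 1; 0; -2], [:: -2; -4; -2]);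
          ([:: 1; 0; -1], [:: -6; -14; -4]); ([:: 1; 0; 0], [:: 5; 6; -1]);
          ([:: 1; 0; 1], [:: 2; 5; 3]); ([:: 1; 1; -2], [:: -2; -4; -2]);
          ([:: 1; 1; -1], [:: 0; 2; 2]); ([:: 1; 1; 0], [:: 2; 6; 4]);
          ([:: 2; -1; -1], [:: -1; -4; -3]); ([:: 2; -1; 0], [:: 2; 2]);
          ([:: 2; 0; -2], [:: -1; -2; -1]); ([:: 2; 0; 0], [:: 1; 2; 1])]].

(* (1+z(1+x)(1+y))(z+(1+x)(1+y))/(xyz) *)
Definition model_epsilon : model := Model
  [:: [:: ([:: 0; 0; 0], [:: 1]); ([:: 0; 0; 1], [:: 1]);
          ([:: 0; 1; 1], [:: 1]); ([:: 1; 0; 1], [:: 1]);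
          ([:: 1; 1; 1], [:: 1])];
      [:: ([:: 0; 0; 0], [:: 1]); ([:: 0; 0; 1], [:: 1]);
          ([:: 0; 1; 0], [:: 1]); ([:: 1; 0; 0], [:: 1]);
          ([:: 1; 1; 0], [:: 1])];
      [:: ([:: -1; -1; -1], [:: 1])]]
  1
  [:: [:: ([:: -2; -1; -1], [:: -2; -16; -14]);
          ([:: -2; -1; 0], [:: -12; -28; -24]);
          ([:: -2; -1; 1], [:: -2; -12; -18]);
          ([:: -2; 0; -1], [:: -2; -10; -12]);
          ([:: -2; 0; 0], [:: -8; -14; -18]);
          ([:: -2; 0; 1], [:: -2; -6; -16]); ([:: -2; 1; 0], [:: -2; -3; 5]);
          ([:: -1; -2; 0], [:: -8; -16; -8]);
          ([:: -1; -1; 0], [:: 10; -10; -24]);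
          ([:: -1; 0; -1], [:: -8; -15; -7]);
          ([:: -1; 0; 0], [:: -3; -36; -49]);
          ([:: -1; 0; 1], [:: -8; -15; -7]); ([:: 0; -2; 0], [:: 22; 44; 22]);
          ([:: 0; -1; -1], [:: 4; 26; 29]); ([:: 0; -1; 0], [:: 38; 25; 3]);
          ([:: 0; -1; 1], [:: 4; 22; 33]); ([:: 0; 0; -1], [:: -4; 5; 16]);
          ([:: 0; 0; 0], [:: 22; -18; -52]); ([:: 0; 0; 1], [:: -4; 1; 20]);
          ([:: 0; 1; 0], [:: 8; 13; -13]); ([:: 1; -2; 0], [:: 13; 26; 13]);
          ([:: 1; -1; -1], [:: 2; 10; 15]); ([:: 1; -1; 0], [:: 26; 28; 6]);
          ([:: 1; -1; 1], [:: 2; 10; 15]); ([:: 1; 0; -1], [:: 2; 10; 11]);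
          ([:: 1; 0; 0], [:: 21; 16; -13]); ([:: 1; 0; 1], [:: 2; 10; 11]);
          ([:: 1; 1; 0], [:: 8; 14; -6]); ([:: 2; -1; 0], [:: 2; 8; 6]);
          ([:: 2; 0; 0], [:: 4; 12; 8]); ([:: 2; 1; 0], [:: 2; 4; 2])];
      [:: ([:: -2; -2; -1], [:: -2; -4; -2]);
          ([:: -2; -2; 0], [:: -4; -12; -8]);
          ([:: -2; -2; 1], [:: -2; -8; -6]); ([:: -2; -1; 0], [:: 8; 16; 8]);
          ([:: -2; 0; -1], [:: 3; 8; 5]); ([:: -2; 0; 0], [:: 10; 34; 24]);
          ([:: -2; 0; 1], [:: 3; 12; 9]); ([:: -2; 1; -1], [:: 1; 4; 3]);
          ([:: -2; 1; 0], [:: 5; 16; 11]); ([:: -2; 1; 1], [:: 1; 4; 3]);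
          ([:: -2; 2; 0], [:: 1; 2; 1]); ([:: -1; -2; -1], [:: -4; -16; -12]);
          ([:: -1; -2; 0], [:: 0; -16; -16]); ([:: -1; -2; 1], [:: -4; 0; 4]);
          ([:: -1; -1; 0], [:: 6; -26; -44]);
          ([:: -1; -1; 1], [:: -8; -8; -4]); ([:: -1; 0; -1], [:: 7; 28; 21]);
          ([:: -1; 0; 0], [:: 28; 39; -33]); ([:: -1; 0; 1], [:: -1; 4; 1]);
          ([:: -1; 1; -1], [:: 3; 12; 9]); ([:: -1; 1; 0], [:: 18; 36; -10]);
          ([:: -1; 1; 1], [:: 3; 12; 9]); ([:: -1; 2; 0], [:: 4; 8; 4]);
          ([:: 0; -2; -1], [:: -3; -32; -29]);
          ([:: 0; -2; 0], [:: -4; -20; -16]);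
          ([:: 0; -2; 1], [:: -3; -12; -9]);
          ([:: 0; -1; -1], [:: 8; -4; -20]);
          ([:: 0; -1; 0], [:: -1; -28; -59]);
          ([:: 0; -1; 1], [:: 0; -12; -24]); ([:: 0; 0; -1], [:: 14; 40; 18]);
          ([:: 0; 0; 0], [:: 14; -2; -60]); ([:: 0; 0; 1], [:: 6; 12; -6]);
          ([:: 0; 1; -1], [:: 3; 12; 9]); ([:: 0; 1; 0], [:: 17; 22; -15]);
          ([:: 0; 1; 1], [:: 3; 12; 9]); ([:: 0; 2; 0], [:: 6; 12; 6]);
          ([:: 1; -2; -1], [:: -1; -3; -2]); ([:: 1; -2; 0], [:: -4; 5; 9]);
          ([:: 1; -2; 1], [:: -1; -3; -2]); ([:: 1; -1; 0], [:: -8; 4; 20]);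
          ([:: 1; 0; -1], [:: 2; 7; 5]); ([:: 1; 0; 0], [:: 0; 1; 17]);
          ([:: 1; 0; 1], [:: 2; 7; 5]); ([:: 1; 1; -1], [:: 1; 4; 3]);
          ([:: 1; 1; 0], [:: 8; 10; 10]); ([:: 1; 1; 1], [:: 1; 4; 3]);
          ([:: 1; 2; 0], [:: 4; 8; 4]); ([:: 2; -2; 0], [:: -1; -2; -1]);
          ([:: 2; 0; 0], [:: 4; 8; 4]); ([:: 2; 1; 0], [:: 4; 8; 4]);
          ([:: 2; 2; 0], [:: 1; 2; 1])];
      [:: ([:: -2; -2; -2], [:: -1; -2; -1]);
          ([:: -2; -2; -1], [:: -4; -8; -4]);
          ([:: -2; -2; 0], [:: -4; -8; -4]); ([:: -2; -2; 2], [:: 1; 2; 1]);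
          ([:: -2; -1; -2], [:: -2; -4; -2]); ([:: -2; -1; 2], [:: 2; 4; 2]);
          ([:: -2; 0; -2], [:: -1; -2; -1]); ([:: -2; 0; 0], [:: 2; 0; -2]);
          ([:: -2; 0; 1], [:: 4; 0; -4]); ([:: -2; 0; 2], [:: 1; 2; 1]);
          ([:: -2; 1; -1], [:: -1; -4; -3]); ([:: -2; 1; 0], [:: 2; -2; -4]);
          ([:: -2; 1; 1], [:: 1; 4; 3]); ([:: -1; -2; -2], [:: -2; -4; -2]);
          ([:: -1; -2; 0], [:: 16; 32; 16]);
          ([:: -1; -2; 1], [:: 16; 32; 16]); ([:: -1; -2; 2], [:: 2; 4; 2]);
          ([:: -1; -1; -2], [:: -4; -8; -4]);
          ([:: -1; -1; -1], [:: -4; -40; -32]);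
          ([:: -1; -1; 0], [:: 8; -20; -16]);
          ([:: -1; -1; 1], [:: 16; 24; 16]); ([:: -1; -1; 2], [:: 4; 8; 4]);
          ([:: -1; 0; -2], [:: -2; -4; -2]);
          ([:: -1; 0; -1], [:: 0; -13; -17]);
          ([:: -1; 0; 0], [:: 14; -12; -2]); ([:: -1; 0; 1], [:: 4; 5; 21]);
          ([:: -1; 0; 2], [:: 2; 4; 2]); ([:: -1; 1; -1], [:: -3; -12; -9]);
          ([:: -1; 1; 0], [:: 8; 4; 10]); ([:: -1; 1; 1], [:: 3; 12; 9]);
          ([:: 0; -2; -2], [:: -1; -2; -1]);
          ([:: 0; -2; -1], [:: 20; 40; 20]); ([:: 0; -2; 0], [:: 18; 36; 18]);
          ([:: 0; -2; 2], [:: 1; 2; 1]); ([:: 0; -1; -2], [:: -2; -4; -2]);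
          ([:: 0; -1; -1], [:: 4; -21; -27]);
          ([:: 0; -1; 0], [:: 30; 6; -20]); ([:: 0; -1; 1], [:: 8; 13; 3]);
          ([:: 0; -1; 2], [:: 2; 4; 2]); ([:: 0; 0; -2], [:: -1; -2; -1]);
          ([:: 0; 0; -1], [:: -8; -29; -23]);
          ([:: 0; 0; 0], [:: 22; -8; -14]); ([:: 0; 0; 1], [:: 8; 29; 23]);
          ([:: 0; 0; 2], [:: 1; 2; 1]); ([:: 0; 1; -1], [:: -3; -12; -9]);
          ([:: 0; 1; 0], [:: 10; 22; 24]); ([:: 0; 1; 1], [:: 3; 12; 9]);
          ([:: 1; -2; -1], [:: -1; -2; -1]); ([:: 1; -2; 0], [:: 10; 20; 10]);
          ([:: 1; -2; 1], [:: 1; 2; 1]); ([:: 1; -1; -1], [:: -3; -7; -11]);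
          ([:: 1; -1; 0], [:: 16; 8; -14]); ([:: 1; -1; 1], [:: 3; 7; 11]);
          ([:: 1; 0; -1], [:: -2; -11; -12]); ([:: 1; 0; 0], [:: 10; 4; -14]);
          ([:: 1; 0; 1], [:: 2; 11; 12]); ([:: 1; 1; -1], [:: -1; -4; -3]);
          ([:: 1; 1; 0], [:: 4; 16; 10]); ([:: 1; 1; 1], [:: 1; 4; 3])]].

(* (1+y+xy)(y+z(1+x)(1+y))(1+z)/(xyz) *)
Definition model_zeta : model := Model
  [:: [:: ([:: 0; 0; 0], [:: 1]); ([:: 0; 1; 0], [:: 1]);
          ([:: 1; 1; 0], [:: 1])];
      [:: ([:: 0; 0; 1], [:: 1]); ([:: 0; 1; 0], [:: 1]);
          ([:: 0; 1; 1], [:: 1]); ([:: 1; 0; 1], [:: 1]);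
          ([:: 1; 1; 1], [:: 1])];
      [:: ([:: 0; 0; 0], [:: 1]); ([:: 0; 0; 1], [:: 1])];
      [:: ([:: -1; -1; -1], [:: 1])]]
  1
  [:: [:: ([:: -2; -1; 0], [:: -3]); ([:: -2; -1; 1], [:: -3; -16; -21]);
          ([:: -2; 0; -1], [:: -3; -15; -14]);
          ([:: -2; 0; 0], [:: -5; -45; -26]);
          ([:: -2; 0; 1], [:: -12; -48; -36]);
          ([:: -2; 1; -1], [:: -3; 0; 5]); ([:: -2; 1; 0], [:: 4; -20; -38]);
          ([:: -2; 1; 1], [:: -3; -20; -33]);
          ([:: -1; -1; 0], [:: -4; -1; -5]);
          ([:: -1; -1; 1], [:: -19; -63; -46]);
          ([:: -1; 0; -1], [:: 6; 20; 23]);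
          ([:: -1; 0; 0], [:: -5; -52; -58]);
          ([:: -1; 0; 1], [:: -21; -94; -108]);
          ([:: -1; 0; 2], [:: 6; 24; 18]); ([:: -1; 1; 0], [:: 22; -24; -72]);
          ([:: -1; 1; 1], [:: -8; -36; -56]);
          ([:: -1; 2; 0], [:: 10; 20; 10]); ([:: 0; -1; 0], [:: 0; 2; -3]);
          ([:: 0; -1; 1], [:: -15; -42; -19]); ([:: 0; 0; -1], [:: 1; 5; 11]);
          ([:: 0; 0; 0], [:: -6; -19; -17]);
          ([:: 0; 0; 1], [:: -21; -80; -71]); ([:: 0; 0; 2], [:: 6; 24; 18]);
          ([:: 0; 1; -1], [:: 4; 14; 8]); ([:: 0; 1; 0], [:: 7; -18; -37]);
          ([:: 0; 1; 1], [:: -6; -22; -32]); ([:: 0; 2; 0], [:: 10; 20; 10]);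
          ([:: 1; -1; 0], [:: 1; 3; 2]); ([:: 1; -1; 1], [:: 1; 5; 6]);
          ([:: 1; 0; 0], [:: 1; 2; -2]); ([:: 1; 0; 1], [:: -5; -12; 4]);
          ([:: 1; 1; -1], [:: 1; 4; 3]); ([:: 2; 0; 0], [:: 1; 2; 1]);
          ([:: 2; 0; 1], [:: 1; 4; 3]); ([:: 2; 1; 0], [:: 1; 4; 3]);
          ([:: 2; 1; 1], [:: 1; 6; 9])];
      [:: ([:: -2; -2; 0], [:: -1; -2; -1]);
          ([:: -2; -2; 1], [:: -1; -4; -3]);
          ([:: -2; -1; -1], [:: -1; -3; -2]);
          ([:: -2; -1; 0], [:: -13; -29; -16]);
          ([:: -2; 0; -1], [:: -3; -7; -4]);
          ([:: -2; 0; 0], [:: -6; -21; -15]);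
          ([:: -2; 0; 1], [:: -1; -4; -3]); ([:: -2; 1; 0], [:: 10; 18; 8]);
          ([:: -2; 2; -1], [:: 2; 4; 2]); ([:: -2; 2; 0], [:: 4; 12; 8]);
          ([:: -2; 2; 1], [:: 2; 8; 6]); ([:: -1; -2; 0], [:: -2; -4; -2]);
          ([:: -1; -2; 1], [:: -2; -8; -6]);
          ([:: -1; -1; -1], [:: -1; -3; -2]);
          ([:: -1; -1; 0], [:: -15; -22; -2]);
          ([:: -1; -1; 1], [:: 13; 17; -23]);
          ([:: -1; -1; 2], [:: 6; 24; 18]); ([:: -1; 0; -1], [:: -3; -3; 4]);
          ([:: -1; 0; 0], [:: -10; 6; 14]); ([:: -1; 0; 1], [:: 34; 89; 14]);
          ([:: -1; 0; 2], [:: 6; 24; 18]); ([:: -1; 1; 0], [:: 32; 64; 56]);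
          ([:: -1; 1; 1], [:: 14; 56; 52]); ([:: -1; 2; -1], [:: 5; 20; 15]);
          ([:: -1; 2; 0], [:: 22; 46; 24]); ([:: -1; 2; 1], [:: 7; 28; 21]);
          ([:: 0; -2; 0], [:: -1; -2; -1]); ([:: 0; -2; 1], [:: -1; -4; -3]);
          ([:: 0; -1; 0], [:: -3; -2; 4]); ([:: 0; -1; 1], [:: -1; -16; -16]);
          ([:: 0; 0; -1], [:: -2; -4; -9]); ([:: 0; 0; 0], [:: -7; 18; 31]);
          ([:: 0; 0; 1], [:: 11; 10; -16]); ([:: 0; 1; -1], [:: 2; 14; 20]);
          ([:: 0; 1; 0], [:: 18; 56; 41]); ([:: 0; 1; 1], [:: 20; 58; 24]);
          ([:: 0; 2; -1], [:: 4; 8; 4]); ([:: 0; 2; 0], [:: 23; 38; 15]);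
          ([:: 0; 2; 1], [:: 9; 36; 27]); ([:: 1; -1; 0], [:: -2; -5; -3]);
          ([:: 1; -1; 1], [:: -2; -9; -9]); ([:: 1; 0; 0], [:: 0; 7; 8]);
          ([:: 1; 0; 1], [:: -7; -29; -24]); ([:: 1; 1; -1], [:: -1; 0; 1]);
          ([:: 1; 1; 0], [:: 6; 22; 21]); ([:: 1; 2; -1], [:: 1; 2; 1]);
          ([:: 1; 2; 0], [:: 6; 16; 10]); ([:: 1; 2; 1], [:: 5; 20; 15]);
          ([:: 2; 0; 0], [:: -1; -2; -1]); ([:: 2; 0; 1], [:: -1; -4; -3]);
          ([:: 2; 2; 0], [:: 1; 2; 1]); ([:: 2; 2; 1], [:: 1; 4; 3])];
      [:: ([:: -2; -2; 0], [:: -1; -2; -1]); ([:: -2; -2; 2], [:: 1; 2; 1]);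
          ([:: -2; -1; -1], [:: -2; -5; -3]);
          ([:: -2; -1; 0], [:: -6; -13; -7]); ([:: -2; -1; 2], [:: 4; 8; 4]);
          ([:: -2; 0; -2], [:: -1; -2; -1]);
          ([:: -2; 0; 0], [:: -11; -34; -23]);
          ([:: -2; 0; 1], [:: -6; -24; -18]); ([:: -2; 0; 2], [:: 6; 12; 6]);
          ([:: -2; 1; -2], [:: -2; -4; -2]);
          ([:: -2; 1; -1], [:: -20; -42; -22]);
          ([:: -2; 1; 0], [:: -22; -46; -24]); ([:: -2; 1; 2], [:: 4; 8; 4]);
          ([:: -2; 2; -2], [:: -1; -2; -1]);
          ([:: -2; 2; -1], [:: -4; -8; -4]); ([:: -2; 2; 0], [:: -4; -8; -4]);
          ([:: -2; 2; 2], [:: 1; 2; 1]); ([:: -1; -2; 0], [:: -2; -4; -2]);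
          ([:: -1; -2; 2], [:: 2; 4; 2]); ([:: -1; -1; -1], [:: -2; -5; -3]);
          ([:: -1; -1; 0], [:: -12; -39; -31]); ([:: -1; -1; 1], [:: 0; -8]);
          ([:: -1; -1; 2], [:: 10; 26; 28]);
          ([:: -1; 0; -1], [:: -12; -30; -24]);
          ([:: -1; 0; 0], [:: -50; -75; -18]);
          ([:: -1; 0; 1], [:: -14; 9; 24]); ([:: -1; 0; 2], [:: 24; 54; 18]);
          ([:: -1; 1; -2], [:: -2; -4; -2]);
          ([:: -1; 1; -1], [:: -20; -44; -17]);
          ([:: -1; 1; 0], [:: -34; -54; 10]);
          ([:: -1; 1; 1], [:: -2; 14; 39]); ([:: -1; 1; 2], [:: 14; 28; 14]);
          ([:: -1; 2; -2], [:: -2; -4; -2]); ([:: -1; 2; 0], [:: -2; -4; -2]);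
          ([:: -1; 2; 2], [:: 4; 8; 4]); ([:: 0; -2; 0], [:: -1; -2; -1]);
          ([:: 0; -2; 2], [:: 1; 2; 1]); ([:: 0; -1; 1], [:: 8; 16; 8]);
          ([:: 0; -1; 2], [:: 8; 16; 8]); ([:: 0; 0; -1], [:: -4; -9; -19]);
          ([:: 0; 0; 0], [:: -13; 16; 36]); ([:: 0; 0; 1], [:: 16; 75; 56]);
          ([:: 0; 0; 2], [:: 25; 50; 1]); ([:: 0; 1; -1], [:: -4; 4; 19]);
          ([:: 0; 1; 0], [:: -2; 26; 63]); ([:: 0; 1; 1], [:: 20; 58; 62]);
          ([:: 0; 1; 2], [:: 18; 36; 18]); ([:: 0; 2; -2], [:: -1; -2; -1]);
          ([:: 0; 2; -1], [:: -8; -16; -8]);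
          ([:: 0; 2; 0], [:: -13; -26; -13]); ([:: 0; 2; 2], [:: 6; 12; 6]);
          ([:: 1; -1; 0], [:: -2; -4; -2]); ([:: 1; -1; 2], [:: 2; 4; 2]);
          ([:: 1; 0; 0], [:: 4; 24; 18]); ([:: 1; 0; 1], [:: 12; 40; 26]);
          ([:: 1; 0; 2], [:: 8; 16; 8]); ([:: 1; 1; -1], [:: -2; -4; -2]);
          ([:: 1; 1; 0], [:: 0; 26; 39]); ([:: 1; 1; 1], [:: 12; 50; 51]);
          ([:: 1; 1; 2], [:: 10; 20; 10]); ([:: 1; 2; -1], [:: -2; -4; -2]);
          ([:: 1; 2; 0], [:: -6; -12; -6]); ([:: 1; 2; 2], [:: 4; 8; 4]);
          ([:: 2; 0; 0], [:: -1; -2; -1]); ([:: 2; 0; 2], [:: 1; 2; 1]);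
          ([:: 2; 1; 0], [:: -2; -4; -2]); ([:: 2; 1; 2], [:: 2; 4; 2]);
          ([:: 2; 2; 0], [:: -1; -2; -1]); ([:: 2; 2; 2], [:: 1; 2; 1])]].

(* (1+x)(1+y)(1+z(1+x)(1+y))(1+1/z)/(xy) *)
Definition model_gamma : model := Model
  [:: [:: ([:: 0; 0; 0], [:: 1]); ([:: 1; 0; 0], [:: 1])];
      [:: ([:: 0; 0; 0], [:: 1]); ([:: 0; 1; 0], [:: 1])];
      [:: ([:: 0; 0; 0], [:: 1]); ([:: 0; 0; 1], [:: 1]);
          ([:: 0; 1; 1], [:: 1]); ([:: 1; 0; 1], [:: 1]);
          ([:: 1; 1; 1], [:: 1])];
      [:: ([:: 0; 0; -1], [:: 1]); ([:: 0; 0; 0], [:: 1])];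
      [:: ([:: -1; -1; 0], [:: 1])]]
  1
  [:: [:: ([:: -2; -1; -1], [:: -3; 0; 5]);
          ([:: -2; -1; 0], [:: 4; -20; -38]);
          ([:: -2; -1; 1], [:: -3; -20; -33]);
          ([:: -2; 0; -1], [:: -3; -15; -14]);
          ([:: -2; 0; 0], [:: -5; -45; -26]);
          ([:: -2; 0; 1], [:: -12; -48; -36]); ([:: -2; 1; 0], [:: -3]);
          ([:: -2; 1; 1], [:: -3; -16; -21]);
          ([:: -1; -2; 0], [:: 10; 20; 10]);
          ([:: -1; -1; 0], [:: 30; 12; -16]);
          ([:: -1; 0; -1], [:: -27; -120; -150]);
          ([:: -1; 0; 0], [:: 2; -65; -82]); ([:: -1; 1; 0], [:: -2; 30; 59]);
          ([:: 0; -2; 0], [:: 10; 20; 10]); ([:: 0; -1; -1], [:: 5; 8; 5]);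
          ([:: 0; -1; 0], [:: 24; 24; 16]); ([:: 0; -1; 1], [:: 11; 72; 117]);
          ([:: 0; 0; -1], [:: -22; -97; -128]);
          ([:: 0; 0; 0], [:: -103; 143; -79]);
          ([:: 0; 0; 1], [:: -86; 290; 132]);
          ([:: 0; 1; 0], [:: 7; -62; 120]); ([:: 0; 1; 1], [:: 11; 56; 69]);
          ([:: 1; -1; -1], [:: 2; 8; 10]); ([:: 1; -1; 1], [:: 10; 64; 102]);
          ([:: 1; 0; -1], [:: 2; 8; 8]); ([:: 1; 0; 0], [:: -106; 175; -15]);
          ([:: 1; 0; 1], [:: -94; 262; 120]); ([:: 1; 1; 0], [:: 8; -88; 63]);
          ([:: 1; 1; 1], [:: 10; 48; 54]); ([:: 2; -1; 0], [:: 2; 8; 6]);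
          ([:: 2; -1; 1], [:: 2; 12; 18]); ([:: 2; 0; 0], [:: 4; 12; 8]);
          ([:: 2; 0; 1], [:: 4; 20; 24]); ([:: 2; 1; 0], [:: 2; 4; 2]);
          ([:: 2; 1; 1], [:: 2; 8; 6])];
      [:: ([:: -2; -2; -1], [:: -2; -4; -2]);
          ([:: -2; -2; 0], [:: -4; -12; -8]);
          ([:: -2; -2; 1], [:: -2; -8; -6]);
          ([:: -2; -1; 0], [:: -10; -18; -8]); ([:: -2; 0; -1], [:: 3; 7; 4]);
          ([:: -2; 0; 0], [:: 6; 21; 15]); ([:: -2; 0; 1], [:: 1; 4; 3]);
          ([:: -2; 1; -1], [:: 1; 3; 2]); ([:: -2; 1; 0], [:: 13; 29; 16]);
          ([:: -2; 2; 0], [:: 1; 2; 1]); ([:: -2; 2; 1], [:: 1; 4; 3]);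
          ([:: -1; -2; -1], [:: -5; -20; -15]);
          ([:: -1; -2; 0], [:: -22; -46; -24]);
          ([:: -1; -2; 1], [:: -7; -28; -21]);
          ([:: -1; -1; -1], [:: -22; -88; -100]);
          ([:: -1; -1; 0], [:: -40; -96; -104]);
          ([:: -1; 0; -1], [:: -14; -59; -79]);
          ([:: -1; 0; 0], [:: 13; 22; -5]); ([:: -1; 0; 1], [:: 13; 70; 93]);
          ([:: -1; 1; -1], [:: 3; 9; 6]); ([:: -1; 1; 0], [:: 35; 80; 79]);
          ([:: -1; 1; 1], [:: 10; 58; 84]); ([:: -1; 2; 0], [:: 4; 8; 4]);
          ([:: -1; 2; 1], [:: 4; 16; 12]); ([:: 0; -2; -1], [:: -4; -8; -4]);
          ([:: 0; -2; 0], [:: -23; -38; -15]);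
          ([:: 0; -2; 1], [:: -9; -36; -27]);
          ([:: 0; -1; -1], [:: 5; 30; 53]);
          ([:: 0; -1; 0], [:: -26; -54; -65]);
          ([:: 0; 0; -1], [:: 12; 47; 63]);
          ([:: 0; 0; 0], [:: 142; -125; -56]);
          ([:: 0; 0; 1], [:: 153; 0; 135]); ([:: 0; 1; -1], [:: 3; 9; 6]);
          ([:: 0; 1; 0], [:: 151; -97]); ([:: 0; 1; 1], [:: 150; -12; 126]);
          ([:: 0; 2; 0], [:: 6; 12; 6]); ([:: 0; 2; 1], [:: 6; 24; 18]);
          ([:: 1; -2; -1], [:: -1; -2; -1]);
          ([:: 1; -2; 0], [:: -6; -16; -10]);
          ([:: 1; -2; 1], [:: -5; -20; -15]);
          ([:: 1; -1; 0], [:: -12; -44; -51]); ([:: 1; 0; -1], [:: 2; 5; 3]);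
          ([:: 1; 0; 0], [:: -3; 76; -104]); ([:: 1; 0; 1], [:: 19; 76; 57]);
          ([:: 1; 1; -1], [:: 1; 3; 2]); ([:: 1; 1; 0], [:: 7; 112; -59]);
          ([:: 1; 1; 1], [:: 18; 72; 54]); ([:: 1; 2; 0], [:: 4; 8; 4]);
          ([:: 1; 2; 1], [:: 4; 16; 12]); ([:: 2; -2; 0], [:: -1; -2; -1]);
          ([:: 2; -2; 1], [:: -1; -4; -3]); ([:: 2; 0; 0], [:: 4; 8; 4]);
          ([:: 2; 0; 1], [:: 4; 16; 12]); ([:: 2; 1; 0], [:: 4; 8; 4]);
          ([:: 2; 1; 1], [:: 4; 16; 12]); ([:: 2; 2; 0], [:: 1; 2; 1]);
          ([:: 2; 2; 1], [:: 1; 4; 3])];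
      [:: ([:: -2; -2; -2], [:: -1; -2; -1]);
          ([:: -2; -2; -1], [:: -4; -8; -4]);
          ([:: -2; -2; 0], [:: -4; -8; -4]); ([:: -2; -2; 2], [:: 1; 2; 1]);
          ([:: -2; -1; -2], [:: -2; -4; -2]);
          ([:: -2; -1; -1], [:: -20; -42; -22]);
          ([:: -2; -1; 0], [:: -22; -46; -24]);
          ([:: -2; -1; 2], [:: 4; 8; 4]); ([:: -2; 0; -2], [:: -1; -2; -1]);
          ([:: -2; 0; 0], [:: -11; -34; -23]);
          ([:: -2; 0; 1], [:: -6; -24; -18]); ([:: -2; 0; 2], [:: 6; 12; 6]);
          ([:: -2; 1; -1], [:: -2; -5; -3]);
          ([:: -2; 1; 0], [:: -6; -13; -7]); ([:: -2; 1; 2], [:: 4; 8; 4]);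
          ([:: -2; 2; 0], [:: -1; -2; -1]); ([:: -2; 2; 2], [:: 1; 2; 1]);
          ([:: -1; -2; -2], [:: -2; -4; -2]);
          ([:: -1; -2; 0], [:: -2; -4; -2]); ([:: -1; -2; 2], [:: 4; 8; 4]);
          ([:: -1; -1; -2], [:: -4; -8; -4]);
          ([:: -1; -1; -1], [:: -4; 38; 85]);
          ([:: -1; -1; 0], [:: 6; 126; 222]);
          ([:: -1; -1; 1], [:: 22; 112; 149]);
          ([:: -1; -1; 2], [:: 16; 32; 16]);
          ([:: -1; 0; -2], [:: -2; -4; -2]);
          ([:: -1; 0; -1], [:: 17; 90; 131]);
          ([:: -1; 0; 0], [:: 19; 162; 263]);
          ([:: -1; 0; 1], [:: 24; 116; 154]);
          ([:: -1; 0; 2], [:: 24; 48; 24]);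
          ([:: -1; 1; -1], [:: -6; -15; -9]);
          ([:: -1; 1; 0], [:: -14; -25; -20]); ([:: -1; 1; 1], [:: 8; 22; 5]);
          ([:: -1; 1; 2], [:: 16; 32; 16]); ([:: -1; 2; 0], [:: -4; -8; -4]);
          ([:: -1; 2; 2], [:: 4; 8; 4]); ([:: 0; -2; -2], [:: -1; -2; -1]);
          ([:: 0; -2; -1], [:: -8; -16; -8]);
          ([:: 0; -2; 0], [:: -13; -26; -13]); ([:: 0; -2; 2], [:: 6; 12; 6]);
          ([:: 0; -1; -2], [:: -2; -4; -2]);
          ([:: 0; -1; -1], [:: -23; -58; -66]);
          ([:: 0; -1; 0], [:: -15; 26; 48]);
          ([:: 0; -1; 1], [:: 30; 128; 136]);
          ([:: 0; -1; 2], [:: 24; 48; 24]); ([:: 0; 0; -2], [:: -1; -2; -1]);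
          ([:: 0; 0; -1], [:: -11; -22; -10]);
          ([:: 0; 0; 0], [:: -26; 0; 95]); ([:: 0; 0; 1], [:: 20; 92; 140]);
          ([:: 0; 0; 2], [:: 36; 72; 36]); ([:: 0; 1; -1], [:: -6; -15; -9]);
          ([:: 0; 1; 0], [:: -154; 45; -83]);
          ([:: 0; 1; 1], [:: -124; 108; -50]);
          ([:: 0; 1; 2], [:: 24; 48; 24]); ([:: 0; 2; 0], [:: -6; -12; -6]);
          ([:: 0; 2; 2], [:: 6; 12; 6]); ([:: 1; -2; -1], [:: -2; -4; -2]);
          ([:: 1; -2; 0], [:: -6; -12; -6]); ([:: 1; -2; 2], [:: 4; 8; 4]);
          ([:: 1; -1; -1], [:: -6; -12; -10]);
          ([:: 1; -1; 0], [:: -14; -28; -39]);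
          ([:: 1; -1; 1], [:: 8; 16; -13]); ([:: 1; -1; 2], [:: 16; 32; 16]);
          ([:: 1; 0; -1], [:: -5; -14; -11]);
          ([:: 1; 0; 0], [:: 87; -236; -67]);
          ([:: 1; 0; 1], [:: 116; -174; -32]);
          ([:: 1; 0; 2], [:: 24; 48; 24]); ([:: 1; 1; -1], [:: -2; -5; -3]);
          ([:: 1; 1; 0], [:: -24; -77; -74]);
          ([:: 1; 1; 1], [:: -6; -40; -55]); ([:: 1; 1; 2], [:: 16; 32; 16]);
          ([:: 1; 2; 0], [:: -4; -8; -4]); ([:: 1; 2; 2], [:: 4; 8; 4]);
          ([:: 2; -2; 0], [:: -1; -2; -1]); ([:: 2; -2; 2], [:: 1; 2; 1]);
          ([:: 2; -1; 0], [:: -4; -8; -4]); ([:: 2; -1; 2], [:: 4; 8; 4]);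
          ([:: 2; 0; 0], [:: -6; -12; -6]); ([:: 2; 0; 2], [:: 6; 12; 6]);
          ([:: 2; 1; 0], [:: -4; -8; -4]); ([:: 2; 1; 2], [:: 4; 8; 4]);
          ([:: 2; 2; 0], [:: -1; -2; -1]); ([:: 2; 2; 2], [:: 1; 2; 1])]].

(* (1+y)(1+z(1+x)(1+y))(1+(1+x)/z)/(xy) *)
Definition model_s7 : model := Model
  [:: [:: ([:: 0; 0; 0], [:: 1]); ([:: 0; 1; 0], [:: 1])];
      [:: ([:: 0; 0; 0], [:: 1]); ([:: 0; 0; 1], [:: 1]);
          ([:: 0; 1; 1], [:: 1]); ([:: 1; 0; 1], [:: 1]);
          ([:: 1; 1; 1], [:: 1])];
      [:: ([:: 0; 0; -1], [:: 1]); ([:: 0; 0; 0], [:: 1]);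
          ([:: 1; 0; -1], [:: 1])];
      [:: ([:: -1; -1; 0], [:: 1])]]
  1
  [:: [:: ([:: -2; -1; -1], [:: -3; -6; -1]);
          ([:: -2; -1; 0], [:: -2; -26; -38]);
          ([:: -2; -1; 1], [:: -3; -20; -33]);
          ([:: -2; 0; -1], [:: -3; -15; -14]);
          ([:: -2; 0; 0], [:: -11; -45; -20]);
          ([:: -2; 0; 1], [:: -12; -48; -36]); ([:: -2; 1; 0], [:: -3]);
          ([:: -2; 1; 1], [:: -3; -16; -21]); ([:: -1; -2; 0], [:: 8; 16; 8]);
          ([:: -1; -1; 0], [:: 16; -14; -44]);
          ([:: -1; 0; -1], [:: -9; -36; -44]);
          ([:: -1; 0; 0], [:: -14; -65; -35]);
          ([:: -1; 1; -1], [:: -1; -2; -1]);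
          ([:: -1; 1; 0], [:: -16; -31; -16]); ([:: 0; -2; 0], [:: 4; 8; 4]);
          ([:: 0; -1; -1], [:: 5; 16; 16]); ([:: 0; -1; 0], [:: 23; 46; 22]);
          ([:: 0; -1; 1], [:: 5; 32; 51]); ([:: 0; 0; -1], [:: -4; -15; -19]);
          ([:: 0; 0; 0], [:: 10; -10; -50]); ([:: 0; 0; 1], [:: 20; 72; 56]);
          ([:: 0; 1; -1], [:: -1; -2; -1]);
          ([:: 0; 1; 0], [:: -19; -52; -26]); ([:: 0; 1; 1], [:: 5; 28; 27]);
          ([:: 1; -1; -1], [:: 2; 10; 15]); ([:: 1; -1; 0], [:: 11; 38; 26]);
          ([:: 1; -1; 1], [:: 2; 12; 18]); ([:: 1; 0; -1], [:: 2; 6; 11]);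
          ([:: 1; 0; 0], [:: 20; 22; -30]); ([:: 1; 0; 1], [:: 8; 24; 20]);
          ([:: 1; 1; 0], [:: -5; -14; -4]); ([:: 1; 1; 1], [:: 2; 12; 6]);
          ([:: 2; -1; 0], [:: 2; 8; 6]); ([:: 2; 0; 0], [:: 8; 12; 4]);
          ([:: 2; 1; 0], [:: 2; 8; 6])];
      [:: ([:: -2; -2; -1], [:: -2; -4; -2]);
          ([:: -2; -2; 0], [:: -4; -12; -8]);
          ([:: -2; -2; 1], [:: -2; -8; -6]);
          ([:: -2; -1; 0], [:: -4; -6; -2]); ([:: -2; 0; -1], [:: 3; 7; 4]);
          ([:: -2; 0; 0], [:: 12; 33; 21]); ([:: -2; 0; 1], [:: 1; 4; 3]);
          ([:: -2; 1; -1], [:: 1; 3; 2]); ([:: -2; 1; 0], [:: 13; 29; 16]);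
          ([:: -2; 2; 0], [:: 1; 2; 1]); ([:: -2; 2; 1], [:: 1; 4; 3]);
          ([:: -1; -2; -1], [:: -4; -16; -12]);
          ([:: -1; -2; 0], [:: -16; -32; -16]);
          ([:: -1; -2; 1], [:: -4; -16; -12]);
          ([:: -1; -1; -1], [:: -14; -40; -32]);
          ([:: -1; -1; 0], [:: -6; -32; -60]);
          ([:: -1; 0; -1], [:: -7; -16; -15]);
          ([:: -1; 0; 0], [:: 28; 8; -47]); ([:: -1; 0; 1], [:: 9; 42; 45]);
          ([:: -1; 1; -1], [:: 3; 8; 5]); ([:: -1; 1; 0], [:: 22; 16; 1]);
          ([:: -1; 1; 1], [:: 8; 38; 42]); ([:: -1; 2; 0], [:: 4; 8; 4]);
          ([:: -1; 2; 1], [:: 3; 12; 9]); ([:: 0; -2; -1], [:: -3; -11; -8]);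
          ([:: 0; -2; 0], [:: -12; -20; -8]);
          ([:: 0; -2; 1], [:: -3; -7; -4]);
          ([:: 0; -1; -1], [:: -14; -44; -36]);
          ([:: 0; -1; 0], [:: -4; -29; -75]);
          ([:: 0; 0; -1], [:: -8; -23; -21]); ([:: 0; 0; 0], [:: 23; 2; -73]);
          ([:: 0; 0; 1], [:: 8; 39; 43]); ([:: 0; 1; -1], [:: 3; 10; 7]);
          ([:: 0; 1; 0], [:: 21; 23]); ([:: 0; 1; 1], [:: 8; 44; 48]);
          ([:: 0; 2; 0], [:: 6; 12; 6]); ([:: 0; 2; 1], [:: 3; 12; 9]);
          ([:: 1; -2; -1], [:: -1; -3; -2]); ([:: 1; -2; 0], [:: -4; -8; -4]);
          ([:: 1; -2; 1], [:: -1; -3; -2]); ([:: 1; -1; 0], [:: 4; 17; 16]);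
          ([:: 1; 0; -1], [:: 2; 7; 5]); ([:: 1; 0; 0], [:: 16; 52; 30]);
          ([:: 1; 0; 1], [:: 0; 12; 12]); ([:: 1; 1; -1], [:: 1; 4; 3]);
          ([:: 1; 1; 0], [:: 12; 35; 14]); ([:: 1; 1; 1], [:: 0; 12; 12]);
          ([:: 1; 2; 0], [:: 4; 8; 4]); ([:: 1; 2; 1], [:: 1; 3; 2]);
          ([:: 2; -2; 0], [:: -1; -2; -1]); ([:: 2; 2; 0], [:: 1; 2; 1])];
      [:: ([:: -2; -2; -2], [:: -1; -2; -1]);
          ([:: -2; -2; -1], [:: -4; -8; -4]);
          ([:: -2; -2; 0], [:: -4; -8; -4]); ([:: -2; -2; 2], [:: 1; 2; 1]);
          ([:: -2; -1; -2], [:: -2; -4; -2]);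
          ([:: -2; -1; -1], [:: -14; -30; -16]);
          ([:: -2; -1; 0], [:: -16; -34; -18]);
          ([:: -2; -1; 2], [:: 4; 8; 4]); ([:: -2; 0; -2], [:: -1; -2; -1]);
          ([:: -2; 0; 0], [:: -11; -34; -23]);
          ([:: -2; 0; 1], [:: -6; -24; -18]); ([:: -2; 0; 2], [:: 6; 12; 6]);
          ([:: -2; 1; -1], [:: -2; -5; -3]);
          ([:: -2; 1; 0], [:: -6; -13; -7]); ([:: -2; 1; 2], [:: 4; 8; 4]);
          ([:: -2; 2; 0], [:: -1; -2; -1]); ([:: -2; 2; 2], [:: 1; 2; 1]);
          ([:: -1; -2; -2], [:: -2; -4; -2]); ([:: -1; -2; 2], [:: 2; 4; 2]);
          ([:: -1; -1; -2], [:: -4; -8; -4]);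
          ([:: -1; -1; -1], [:: -5; -7; 12]);
          ([:: -1; -1; 0], [:: 10; 52; 84]);
          ([:: -1; -1; 1], [:: 13; 61; 76]); ([:: -1; -1; 2], [:: 8; 16; 8]);
          ([:: -1; 0; -2], [:: -2; -4; -2]); ([:: -1; 0; -1], [:: -3; 1; 21]);
          ([:: -1; 0; 0], [:: -11; 17; 77]); ([:: -1; 0; 1], [:: 18; 70; 68]);
          ([:: -1; 0; 2], [:: 12; 24; 12]);
          ([:: -1; 1; -1], [:: -6; -14; -8]);
          ([:: -1; 1; 0], [:: -15; -10; 10]); ([:: -1; 1; 1], [:: 5; 15; 10]);
          ([:: -1; 1; 2], [:: 8; 16; 8]); ([:: -1; 2; 0], [:: -4; -8; -4]);
          ([:: -1; 2; 2], [:: 2; 4; 2]); ([:: 0; -2; -2], [:: -1; -2; -1]);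
          ([:: 0; -2; -1], [:: -1; -2; -1]); ([:: 0; -2; 0], [:: 2; 4; 2]);
          ([:: 0; -2; 1], [:: 5; 10; 5]); ([:: 0; -2; 2], [:: 1; 2; 1]);
          ([:: 0; -1; -2], [:: -2; -4; -2]); ([:: 0; -1; -1], [:: 6; 22; 12]);
          ([:: 0; -1; 0], [:: 19; 57; 64]); ([:: 0; -1; 1], [:: 21; 45; 36]);
          ([:: 0; -1; 2], [:: 4; 8; 4]); ([:: 0; 0; -2], [:: -1; -2; -1]);
          ([:: 0; 0; -1], [:: -13; -22; -19]);
          ([:: 0; 0; 0], [:: -19; 3; 50]); ([:: 0; 0; 1], [:: 9; 42; 57]);
          ([:: 0; 0; 2], [:: 6; 12; 6]); ([:: 0; 1; -1], [:: -5; -14; -9]);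
          ([:: 0; 1; 0], [:: -29; -54; -47]); ([:: 0; 1; 1], [:: 3; 13; -14]);
          ([:: 0; 1; 2], [:: 4; 8; 4]); ([:: 0; 2; 0], [:: -6; -12; -6]);
          ([:: 0; 2; 2], [:: 1; 2; 1]); ([:: 1; -2; -1], [:: -1; -2; -1]);
          ([:: 1; -2; 0], [:: 2; 4; 2]); ([:: 1; -2; 1], [:: 1; 2; 1]);
          ([:: 1; -1; -1], [:: -3; -7; -11]); ([:: 1; -1; 0], [:: 13; 23; 5]);
          ([:: 1; -1; 1], [:: 4; 12; 16]); ([:: 1; 0; -1], [:: -6; -11; -12]);
          ([:: 1; 0; 0], [:: -25; -48; -31]); ([:: 1; 0; 1], [:: -2; 20; 26]);
          ([:: 1; 1; -1], [:: -1; -4; -3]);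
          ([:: 1; 1; 0], [:: -21; -57; -63]); ([:: 1; 1; 1], [:: 4; 12; 4]);
          ([:: 1; 2; 0], [:: -3; -6; -3]); ([:: 1; 2; 1], [:: 1; 2; 1]);
          ([:: 2; 0; 0], [:: -8; -4; 4])]].

(* (1+x)(1+y)(1+z)(1+xyz)/(xyz) *)
Definition model_s10 : model := Model
  [:: [:: ([:: 0; 0; 0], [:: 1]); ([:: 1; 0; 0], [:: 1])];
      [:: ([:: 0; 0; 0], [:: 1]); ([:: 0; 1; 0], [:: 1])];
      [:: ([:: 0; 0; 0], [:: 1]); ([:: 0; 0; 1], [:: 1])];
      [:: ([:: 0; 0; 0], [:: 1]); ([:: 1; 1; 1], [:: 1])];
      [:: ([:: -1; -1; -1], [:: 1])]]
  1
  [:: [:: ([:: -2; -1; -1], [:: -1; -6; -9]);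
          ([:: -2; -1; 0], [:: -1; -4; -3]);
          ([:: -2; 0; -1], [:: -1; -4; -3]); ([:: -2; 0; 0], [:: -1; -2; -1]);
          ([:: -1; -1; 0], [:: -1; -5; -7]); ([:: -1; 0; -1], [:: 0; 3; 8]);
          ([:: -1; 0; 0], [:: -2; -10; -26]);
          ([:: -1; 0; 1], [:: -1; -3; -5]); ([:: -1; 1; 0], [:: -1; -5; -7]);
          ([:: -1; 1; 1], [:: -1; -2; -1]); ([:: 0; -1; -1], [:: 2; 8; 10]);
          ([:: 0; -1; 0], [:: 1; 4; 3]); ([:: 0; 0; -1], [:: 2; 10; 16]);
          ([:: 0; 0; 1], [:: -2; -10; -16]); ([:: 0; 1; 0], [:: -1; -4; -3]);
          ([:: 0; 1; 1], [:: -2; -8; -10]); ([:: 1; -1; -1], [:: 1; 2; 1]);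
          ([:: 1; -1; 0], [:: 1; 5; 7]); ([:: 1; 0; -1], [:: 1; 3; 5]);
          ([:: 1; 0; 0], [:: 2; 10; 26]); ([:: 1; 0; 1], [:: 0; -3; -8]);
          ([:: 1; 1; 0], [:: 1; 5; 7]); ([:: 2; 0; 0], [:: 1; 2; 1]);
          ([:: 2; 0; 1], [:: 1; 4; 3]); ([:: 2; 1; 0], [:: 1; 4; 3]);
          ([:: 2; 1; 1], [:: 1; 6; 9])];
      [:: ([:: -2; -2; -1], [:: -1; -4; -3]);
          ([:: -2; -2; 0], [:: -1; -2; -1]); ([:: -2; 0; -1], [:: 1; 4; 3]);
          ([:: -2; 0; 0], [:: 1; 2; 1]); ([:: -1; -2; -1], [:: -2; -8; -6]);
          ([:: -1; -2; 0], [:: -2; -4; -2]); ([:: -1; -1; 0], [:: -2; -7]);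
          ([:: -1; -1; 1], [:: -1; -3; -2]); ([:: -1; 0; -1], [:: 3; 11; 8]);
          ([:: -1; 0; 0], [:: 1; 5; 12]); ([:: -1; 0; 1], [:: -1; -3; -2]);
          ([:: -1; 1; -1], [:: 1; 3; 2]); ([:: -1; 1; 0], [:: 1; 8; 10]);
          ([:: 0; -2; -1], [:: -1; -4; -3]); ([:: 0; -2; 0], [:: -1; -2; -1]);
          ([:: 0; -1; 0], [:: -3; -17; -18]);
          ([:: 0; -1; 1], [:: -2; -6; -4]); ([:: 0; 0; -1], [:: 3; 10; 7]);
          ([:: 0; 0; 1], [:: -3; -10; -7]); ([:: 0; 1; -1], [:: 2; 6; 4]);
          ([:: 0; 1; 0], [:: 3; 17; 18]); ([:: 0; 2; 0], [:: 1; 2; 1]);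
          ([:: 0; 2; 1], [:: 1; 4; 3]); ([:: 1; -1; 0], [:: -1; -8; -10]);
          ([:: 1; -1; 1], [:: -1; -3; -2]); ([:: 1; 0; -1], [:: 1; 3; 2]);
          ([:: 1; 0; 0], [:: -1; -5; -12]); ([:: 1; 0; 1], [:: -3; -11; -8]);
          ([:: 1; 1; -1], [:: 1; 3; 2]); ([:: 1; 1; 0], [:: 2; 7]);
          ([:: 1; 2; 0], [:: 2; 4; 2]); ([:: 1; 2; 1], [:: 2; 8; 6]);
          ([:: 2; 0; 0], [:: -1; -2; -1]); ([:: 2; 0; 1], [:: -1; -4; -3]);
          ([:: 2; 2; 0], [:: 1; 2; 1]); ([:: 2; 2; 1], [:: 1; 4; 3])];
      [:: ([:: -2; -2; -2], [:: -1; -2; -1]); ([:: -2; -2; 0], [:: 1; 2; 1]);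
          ([:: -2; -1; -2], [:: -2; -4; -2]); ([:: -2; -1; 0], [:: 2; 4; 2]);
          ([:: -2; 0; -2], [:: -1; -2; -1]); ([:: -2; 0; 0], [:: 1; 2; 1]);
          ([:: -1; -2; -2], [:: -2; -4; -2]); ([:: -1; -2; 0], [:: 2; 4; 2]);
          ([:: -1; -1; -2], [:: -4; -8; -4]);
          ([:: -1; -1; -1], [:: -4; -16; -18]);
          ([:: -1; -1; 0], [:: 2; -3; -11]); ([:: -1; -1; 1], [:: 2; 5; 3]);
          ([:: -1; 0; -2], [:: -2; -4; -2]);
          ([:: -1; 0; -1], [:: -5; -15; -13]);
          ([:: -1; 0; 0], [:: 2; -1; -3]); ([:: -1; 0; 1], [:: 5; 10; 8]);
          ([:: -1; 1; -1], [:: -2; -5; -3]); ([:: -1; 1; 0], [:: 1; 1]);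
          ([:: -1; 1; 1], [:: 3; 6; 3]); ([:: 0; -2; -2], [:: -1; -2; -1]);
          ([:: 0; -2; 0], [:: 1; 2; 1]); ([:: 0; -1; -2], [:: -2; -4; -2]);
          ([:: 0; -1; -1], [:: -6; -12; -4]); ([:: 0; -1; 0], [:: 0; 2; 4]);
          ([:: 0; -1; 1], [:: 4; 10; 6]); ([:: 0; 0; -2], [:: -1; -2; -1]);
          ([:: 0; 0; -1], [:: -9; -17; -12]); ([:: 0; 0; 1], [:: 9; 17; 12]);
          ([:: 0; 0; 2], [:: 1; 2; 1]); ([:: 0; 1; -1], [:: -4; -10; -6]);
          ([:: 0; 1; 0], [:: 0; -2; -4]); ([:: 0; 1; 1], [:: 6; 12; 4]);
          ([:: 0; 1; 2], [:: 2; 4; 2]); ([:: 0; 2; 0], [:: -1; -2; -1]);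
          ([:: 0; 2; 2], [:: 1; 2; 1]); ([:: 1; -1; -1], [:: -3; -6; -3]);
          ([:: 1; -1; 0], [:: -1; -1]); ([:: 1; -1; 1], [:: 2; 5; 3]);
          ([:: 1; 0; -1], [:: -5; -10; -8]); ([:: 1; 0; 0], [:: -2; 1; 3]);
          ([:: 1; 0; 1], [:: 5; 15; 13]); ([:: 1; 0; 2], [:: 2; 4; 2]);
          ([:: 1; 1; -1], [:: -2; -5; -3]); ([:: 1; 1; 0], [:: -2; 3; 11]);
          ([:: 1; 1; 1], [:: 4; 16; 18]); ([:: 1; 1; 2], [:: 4; 8; 4]);
          ([:: 1; 2; 0], [:: -2; -4; -2]); ([:: 1; 2; 2], [:: 2; 4; 2]);
          ([:: 2; 0; 0], [:: -1; -2; -1]); ([:: 2; 0; 2], [:: 1; 2; 1]);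
          ([:: 2; 1; 0], [:: -2; -4; -2]); ([:: 2; 1; 2], [:: 2; 4; 2]);
          ([:: 2; 2; 0], [:: -1; -2; -1]); ([:: 2; 2; 2], [:: 1; 2; 1])]].

(* With [h1 = x+1/y-y], [h2 = x-1/y+y], [q1 = (x^3-y^3+1/y^3+3x)/h1] and
   [q2 = (x^3+y^3-1/y^3+3x)/h2]: (q2+z h1)(q1+z h2)/(xz), a mutation of
   (1+z(x^3-y^3+1/y^3+3x)/x)(1+z(x^3+y^3-1/y^3+3x)/x)/z, which is
   [reflexive_model_s18] with [x^2], [y^6] in place of [x], [y] *)
Definition model_s18 : model := Model
  [:: [:: ([:: 0; -2; 0], [:: 1]); ([:: 0; -1; 1], [:: 1]);
          ([:: 0; 0; 0], [:: 1]); ([:: 0; 1; 1], [:: -1]);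
          ([:: 0; 2; 0], [:: 1]); ([:: 1; -1; 0], [:: 1]);
          ([:: 1; 0; 1], [:: 1]); ([:: 1; 1; 0], [:: -1]);
          ([:: 2; 0; 0], [:: 1])];
      [:: ([:: 0; -2; 0], [:: 1]); ([:: 0; -1; 1], [:: -1]);
          ([:: 0; 0; 0], [:: 1]); ([:: 0; 1; 1], [:: 1]);
          ([:: 0; 2; 0], [:: 1]); ([:: 1; -1; 0], [:: -1]);
          ([:: 1; 0; 1], [:: 1]); ([:: 1; 1; 0], [:: 1]);
          ([:: 2; 0; 0], [:: 1])];
      [:: ([:: -1; 0; -1], [:: 1])]]
  48
  [:: [:: ([:: -2; -6; 0], [:: 0; 192; 192]);
          ([:: -2; -4; -2], [:: -288; 1152; -864]);
          ([:: -2; -4; 2], [:: 96; 0; -96]);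
          ([:: -2; -2; -2], [:: 192; 1152; -1344]);
          ([:: -2; -2; 2], [:: -352; 64; 288]);
          ([:: -2; 0; -2], [:: 1248; 0; -1248]);
          ([:: -2; 0; 0], [:: 288; -960; -96]);
          ([:: -2; 0; 2], [:: 416; -128; -288]);
          ([:: -2; 2; -2], [:: 1728; -1152; -576]);
          ([:: -2; 2; 2], [:: -160; 64; 96]);
          ([:: -2; 4; -2], [:: 1248; -1152; -96]);
          ([:: -2; 6; -2], [:: 192; 0; -192]);
          ([:: -2; 6; 0], [:: 288; 192; -96]);
          ([:: -1; -2; -1], [:: 1152; -4032; 2880]);
          ([:: -1; -2; 1], [:: -768; 1872; -240]);
          ([:: -1; 0; -1], [:: -576; -2880; 3456]);
          ([:: -1; 0; 1], [:: -192; -1152; -384]);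
          ([:: -1; 2; -1], [:: -1152; 1728; -576]);
          ([:: -1; 2; 1], [:: -192; 432; 624]);
          ([:: 0; -6; -2], [:: 0; 0; -192]);
          ([:: 0; -4; -2], [:: 96; 384; 288]);
          ([:: 0; -2; -2], [:: 768; -960; -2880]);
          ([:: 0; -2; 2], [:: -128; 128; 192]);
          ([:: 0; 0; -2], [:: -864; -4416; -3552]); ([:: 0; 0; 0], [:: -576]);
          ([:: 0; 0; 2], [:: -288; -576; -288]);
          ([:: 0; 2; -2], [:: -960; -2112]);
          ([:: 0; 2; 2], [:: -32; 128; 96]);
          ([:: 0; 4; -2], [:: 672; 384; -288]); ([:: 0; 6; -2], [:: 0; -192]);
          ([:: 1; -4; -1], [:: 48; 520]);
          ([:: 1; -2; -1], [:: 800; -1834; 1160]);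
          ([:: 1; -2; 1], [:: -240; 265; -108]);
          ([:: 1; 0; -1], [:: -496; -134; 2088]);
          ([:: 1; 0; 1], [:: -480; -924; -112]);
          ([:: 1; 2; -1], [:: -1120; 1218; 504]);
          ([:: 1; 2; 1], [:: -48; 83; -356]);
          ([:: 1; 4; -1], [:: 48; 212; 784]);
          ([:: 2; -2; -2], [:: 768; -768; -768]);
          ([:: 2; 0; -2], [:: -192; -1536; -1344]);
          ([:: 2; 0; 0], [:: 0; 960; 1056]);
          ([:: 2; 0; 2], [:: -96; -192; -96]);
          ([:: 2; 2; -2], [:: -864; 0; 96]);
          ([:: 3; -2; -1], [:: 304; -173; 28]);
          ([:: 3; 0; -1], [:: 192; 1080; 416]);
          ([:: 3; 0; 1], [:: -144; -126; 136]);
          ([:: 3; 2; -1], [:: -80; 201; 276]); ([:: 4; -2; -2], [:: 192]);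
          ([:: 4; 0; -2], [:: 0; -192; -192]);
          ([:: 4; 0; 0], [:: 0; 288; 288]);
          ([:: 4; 2; -2], [:: -96; 192; 96]);
          ([:: 5; 0; -1], [:: 48; 222; 56])];
      [:: ([:: -2; -4; -2], [:: -288; 0; 288]);
          ([:: -2; -4; 2], [:: -32; 0; 32]);
          ([:: -2; -2; -2], [:: -576; 0; 576]);
          ([:: -2; -2; 2], [:: 96; 0; -96]);
          ([:: -2; 0; -2], [:: -864; 0; 864]);
          ([:: -2; 0; 0], [:: -96; 0; 96]); ([:: -2; 0; 2], [:: -96; 0; 96]);
          ([:: -2; 2; -2], [:: -576; 0; 576]);
          ([:: -2; 2; 2], [:: 32; 0; -32]);
          ([:: -2; 4; -2], [:: -288; 0; 288]);
          ([:: -2; 6; 0], [:: 96; 0; -96]);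
          ([:: -1; -4; -1], [:: 0; 384; 768]);
          ([:: -1; -2; -1], [:: 0; 1440; 288]);
          ([:: -1; -2; 1], [:: 192; -432; 528]);
          ([:: -1; 0; -1], [:: -1728; 3168; 288]);
          ([:: -1; 0; 1], [:: -192; 96; -1056]);
          ([:: -1; 2; -1], [:: 0; 1056; -480]);
          ([:: -1; 2; 1], [:: 0; 336; 528]); ([:: 0; -6; -2], [:: 0; -192]);
          ([:: 0; -4; -2], [:: -96; -960; -480]);
          ([:: 0; -2; -2], [:: -1152; -576; 192]);
          ([:: 0; -2; 2], [:: 128; 64]);
          ([:: 0; 0; -2], [:: -2208; 1920; 288]);
          ([:: 0; 0; 2], [:: 32; 0; -32]);
          ([:: 0; 2; -2], [:: -192; 960; 768]);
          ([:: 0; 2; 2], [:: -160; -64; 32]);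
          ([:: 0; 4; -2], [:: 864; 576; 96]); ([:: 0; 6; -2], [:: 192]);
          ([:: 1; -4; -1], [:: 128; -298; -72]);
          ([:: 1; -2; -1], [:: -448; 700; 608]);
          ([:: 1; -2; 1], [:: 246; 99; 348]);
          ([:: 1; 0; -1], [:: -576; 1314; 2280]);
          ([:: 1; 0; 1], [:: 276; -966; -600]);
          ([:: 1; 2; -1], [:: -320; 220; 1344]);
          ([:: 1; 2; 1], [:: -330; 195; 156]);
          ([:: 1; 4; -1], [:: 64; -10; 664]);
          ([:: 2; -4; -2], [:: 0; -192; -192]);
          ([:: 2; -2; -2], [:: -384; -192; 192]);
          ([:: 2; 0; -2], [:: -576; 1152; -576]);
          ([:: 2; 0; 0], [:: 318; -1608; 576]);
          ([:: 2; 0; 2], [:: 32; 0; -32]);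
          ([:: 2; 2; -2], [:: -96; 192; 288]); ([:: 2; 4; -2], [:: 192; 192]);
          ([:: 3; -2; -1], [:: -384; 11; -228]);
          ([:: 3; 0; -1], [:: 0; -404; 1456]);
          ([:: 3; 0; 1], [:: 138; -238; -376]);
          ([:: 3; 2; -1], [:: 192; 363; 284]);
          ([:: 4; -2; -2], [:: -192; -192; -192]);
          ([:: 4; 0; 0], [:: 106; -238; -344]);
          ([:: 4; 2; -2], [:: 96; 384; 96])];
      [:: ([:: -2; -8; -2], [:: -48; -96; -48]);
          ([:: -2; -6; -2], [:: -192; -384; -192]);
          ([:: -2; -4; -2], [:: -192; -960; -768]);
          ([:: -2; -4; 2], [:: 80; 96; 16]);
          ([:: -2; -2; -2], [:: -960; -1536; -576]);
          ([:: -2; -2; 2], [:: -416; -384; 32]);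
          ([:: -2; 0; -2], [:: -2160; -1824; 336]);
          ([:: -2; 0; 0], [:: -96; 0; 96]);
          ([:: -2; 0; 2], [:: 640; 576; -64]);
          ([:: -2; 2; -2], [:: -2496; -1536; 960]);
          ([:: -2; 2; 2], [:: -352; -384; -32]);
          ([:: -2; 4; -2], [:: -1728; -960; 768]);
          ([:: -2; 4; 2], [:: 48; 96; 48]); ([:: -2; 6; -2], [:: -384; -384]);
          ([:: -2; 6; 0], [:: 96; 0; -96]);
          ([:: -2; 8; -2], [:: -48; -96; -48]);
          ([:: -1; -4; -1], [:: -192; -1536; -2592]);
          ([:: -1; -2; -1], [:: -192; -2688]);
          ([:: -1; -2; 1], [:: -576; 1008; 1296]);
          ([:: -1; 0; -1], [:: -1536; 1344; 1056]);
          ([:: -1; 0; 1], [:: 1344; -2304; -1344]);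
          ([:: -1; 2; -1], [:: -1344; 3456; -384]);
          ([:: -1; 2; 1], [:: -384; -240; 48]);
          ([:: -1; 4; -1], [:: -192; 0; 480]);
          ([:: 0; -6; -2], [:: -96; 192; 96]);
          ([:: 0; -4; -2], [:: -480; 192; 1056]);
          ([:: 0; -2; -2], [:: -1152; 192; -2112]);
          ([:: 0; -2; 2], [:: -96; -64; -32]);
          ([:: 0; 0; -2], [:: -2016; -1152; -2976]);
          ([:: 0; 0; 0], [:: 384; -1536]); ([:: 0; 0; 2], [:: 288; 384; 96]);
          ([:: 0; 2; -2], [:: -1344; -1728]);
          ([:: 0; 2; 2], [:: -64; -64; -64]);
          ([:: 0; 4; -2], [:: 480; 576; -288]);
          ([:: 0; 6; -2], [:: 288; 0; -96]);
          ([:: 1; -2; -1], [:: 812; -2750; -2440]);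
          ([:: 1; -2; 1], [:: -374; 391; -84]);
          ([:: 1; 0; -1], [:: -956; -2058; 1016]);
          ([:: 1; 0; 1], [:: 1176; 1988; 1136]);
          ([:: 1; 2; -1], [:: -1148; 102; 1352]);
          ([:: 1; 2; 1], [:: -34; -267; -956]);
          ([:: 1; 4; -1], [:: 152; 644; 1584]);
          ([:: 2; -4; -2], [:: -144; 96; 240]);
          ([:: 2; -2; -2], [:: 960; -1152; -2496]);
          ([:: 2; 0; -2], [:: -192; -3072; -4416]);
          ([:: 2; 0; 0], [:: 1128; 2592; 1632]);
          ([:: 2; 0; 2], [:: 144; 288; 144]);
          ([:: 2; 2; -2], [:: -672; -1344; -672]);
          ([:: 2; 4; -2], [:: 240; 96; -144]);
          ([:: 3; -2; -1], [:: 758; -299; -316]);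
          ([:: 3; 0; -1], [:: -144; -8; -640]);
          ([:: 3; 0; 1], [:: 492; 910; 536]);
          ([:: 3; 2; -1], [:: -30; 551; 812]);
          ([:: 4; -2; -2], [:: 480; 192; -96]);
          ([:: 4; 0; -2], [:: -384; -960; -960]);
          ([:: 4; 0; 0], [:: 504; 824; 320]);
          ([:: 4; 2; -2], [:: 0; 384; 192]);
          ([:: 5; 0; -1], [:: 108; 106; -120]);
          ([:: 6; 0; -2], [:: -48; -96; -48])]].

(* (1+z(x+3))^2/z - z(1-y)^2/(xy) *)
Definition reflexive_model_s18 : model := Model
  [:: [:: ([:: -1; -1; 1], [:: -1]); ([:: -1; 0; 1], [:: 2]);
          ([:: -1; 1; 1], [:: -1]); ([:: 0; 0; -1], [:: 1]);
          ([:: 0; 0; 0], [:: 6]); ([:: 0; 0; 1], [:: 9]);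
          ([:: 1; 0; 0], [:: 2]); ([:: 1; 0; 1], [:: 6]);
          ([:: 2; 0; 1], [:: 1])]]
  1
  [:: [:: ([:: -1; -1; 1], [:: 24; 24; -48]); ([:: -1; 0; 0], [:: 0; 0; -32]);
          ([:: -1; 0; 1], [:: -24; -24; 144]);
          ([:: 0; -1; 1], [:: -2; -10; -16]);
          ([:: 0; 0; -1], [:: 20; 36; -8]); ([:: 0; 0; 0], [:: 24; 24; -72]);
          ([:: 0; 0; 1], [:: -104; -160; 208]);
          ([:: 0; 1; 1], [:: -2; -10; -16]); ([:: 1; 0; -1], [:: 2; 8; 8]);
          ([:: 1; 0; 0], [:: 20; 48; 16]); ([:: 1; 0; 1], [:: -54; -96; 48]);
          ([:: 2; 0; 0], [:: 4; 12; 8]); ([:: 3; 0; 1], [:: 2; 4])];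
      [:: ([:: -1; -1; 0], [:: 0; 8; 8]); ([:: -1; -1; 1], [:: -36; -36; 48]);
          ([:: -1; 0; 1], [:: 72; 72; -144]); ([:: -1; 1; 0], [:: 0; -8; -8]);
          ([:: -1; 1; 1], [:: -36; -36; 96]); ([:: 0; -1; 1], [:: 0; 18; 48]);
          ([:: 0; 0; -1], [:: -24; -24; 48]);
          ([:: 0; 0; 1], [:: 216; 216; -432]);
          ([:: 0; 1; 1], [:: 0; -18; -48]); ([:: 1; 0; 0], [:: -24; -24; 48]);
          ([:: 1; 0; 1], [:: 72; 72; -144])];
      [:: ([:: -2; -2; 2], [:: 1; 2; 1]); ([:: -2; -1; 2], [:: -4; -8; -4]);
          ([:: -2; 0; 2], [:: 6; 12; 6]); ([:: -2; 1; 2], [:: -4; -8; -4]);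
          ([:: -2; 2; 2], [:: 1; 2; 1]); ([:: -1; -1; 0], [:: 0; 4; 4]);
          ([:: -1; -1; 1], [:: -16; -12; 10]);
          ([:: -1; -1; 2], [:: -18; -36; -18]);
          ([:: -1; 0; 0], [:: 0; 8; -8]); ([:: -1; 0; 1], [:: -16; 24; 76]);
          ([:: -1; 0; 2], [:: 36; 72; 36]); ([:: -1; 1; 0], [:: 0; 4; 4]);
          ([:: -1; 1; 1], [:: 32; 36; -86]);
          ([:: -1; 1; 2], [:: -18; -36; -18]);
          ([:: 0; -1; 1], [:: -2; 10; 26]);
          ([:: 0; -1; 2], [:: -12; -24; -12]);
          ([:: 0; 0; -2], [:: -1; -2; -1]); ([:: 0; 0; -1], [:: -4; 0; 10]);
          ([:: 0; 0; 0], [:: 12; 48]); ([:: 0; 0; 1], [:: 76; 140; -206]);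
          ([:: 0; 0; 2], [:: 105; 210; 105]); ([:: 0; 1; 1], [:: -2; 10; 26]);
          ([:: 0; 1; 2], [:: -12; -24; -12]);
          ([:: 1; -1; 2], [:: -2; -4; -2]); ([:: 1; 0; -1], [:: -2; -6; -6]);
          ([:: 1; 0; 0], [:: 36; 72]); ([:: 1; 0; 1], [:: 162; 294; -102]);
          ([:: 1; 0; 2], [:: 112; 224; 112]); ([:: 1; 1; 2], [:: -2; -4; -2]);
          ([:: 2; 0; 1], [:: 52; 108; 26]); ([:: 2; 0; 2], [:: 54; 108; 54]);
          ([:: 3; 0; 1], [:: 2; 6; 6]); ([:: 3; 0; 2], [:: 12; 24; 12]);
          ([:: 4; 0; 2], [:: 1; 2; 1])]].

Definition factored_model (s : sporadic) : model :=
  match s with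
  | spA => model_A
  | spB => model_B
  | spC => model_C
  | spD => model_D
  | spE => model_E
  | spF => model_F
  | sp_delta => model_delta
  | sp_eta => model_eta
  | sp_alpha => model_alpha
  | sp_epsilon => model_epsilon
  | sp_zeta => model_zeta
  | sp_gamma => model_gamma
  | sp_s7 => model_s7
  | sp_s10 => model_s10
  | sp_s18 => model_s18
  end.

Definition reflexive_model (s : sporadic) : model :=
  match s with
  | spE => reflexive_model_E
  | spF => reflexive_model_F
  | sp_s18 => reflexive_model_s18
  | _ => factored_model s
  end.

Definition frames (s : sporadic) : frame :=
  match s with
  | spA => Frame
      [:: [:: -1; 0]; [:: 0; -1]; [:: 1; 1]]
      [:: ([:: 0; 1; 1], [:: 1]); ([:: 1; 0; 1], [:: 0; 1])]
      [:: [:: -1; 0]; [:: 0; 1]; [:: 1; -1]]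
      [:: ([:: 0; 1; 1], [:: 1]); ([:: 0; 1], [:: 1; 0; 1])]
  | spB => Frame
      [:: [:: -1; 0]; [:: 0; -1]; [:: 1; 1]]
      [:: ([:: 0; 1; 1], [:: 1]); ([:: 1; 0; 1], [:: 0; 1])]
      [:: [:: -1; -1]; [:: -1; 2]; [:: 2; -1]]
      [:: ([:: 0; 1; 2], [:: 2; 1]); ([:: 0; 2; 1], [:: 2; 0; 1])]
  | spC => Frame
      [:: [:: -1; 0]; [:: 0; -1]; [:: 1; 1]]
      [:: ([:: 0; 1; 1], [:: 1]); ([:: 1; 0; 1], [:: 0; 1])]
      [:: [:: -1; 0]; [:: 0; 1]; [:: 1; -1]]
      [:: ([:: 0; 1; 1], [:: 1]); ([:: 0; 1], [:: 1; 0; 1])]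
  | spD => Frame
      [:: [:: -1; 0]; [:: 0; -1]; [:: 1; 1]]
      [:: ([:: 0; 1; 1], [:: 1]); ([:: 1; 0; 1], [:: 0; 1])]
      [:: [:: -1; 0]; [:: 0; 1]; [:: 1; -1]]
      [:: ([:: 0; 1; 1], [:: 1]); ([:: 0; 1], [:: 1; 0; 1])]
  | spE => Frame
      [:: [:: -1; -1]; [:: -1; 1]; [:: 1; -1]; [:: 1; 1]]
      [:: ([:: 0; 0; 1; 1], [:: 1; 1]); ([:: 0; 1; 0; 1], [:: 1; 0; 1])]
      [:: [:: -1; 0]; [:: 0; -1]; [:: 0; 1]; [:: 1; 0]]
      [:: ([:: 0; 0; 0; 1], [:: 1]); ([:: 0; 0; 1], [:: 0; 1])]
  | spF => Frame
      [:: [:: -1; 0]; [:: 0; -1]; [:: 1; 1]]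
      [:: ([:: 0; 1; 1], [:: 1]); ([:: 1; 0; 1], [:: 0; 1])]
      [:: [:: -1; 0]; [:: 0; 1]; [:: 1; -1]]
      [:: ([:: 0; 1; 1], [:: 1]); ([:: 0; 1], [:: 1; 0; 1])]
  | sp_delta => Frame
      [:: [:: -1; 0; 0]; [:: 0; -1; 0]; [:: 0; 0; -1]; [:: 1; 1; 2]]
      [:: ([:: 0; 1; 2; 1], [:: 1]); ([:: 1; 0; 2; 1], [:: 0; 1]);
        ([:: 1; 1; 0; 1], [:: 0; 0; 1])]
      [:: [:: 0; 0; -1]; [:: -1; 0; 1]; [:: -1; 2; 0]; [:: 2; -1; 0]]
      [:: ([:: 0; 0; 1; 2], [:: 1; 1]); ([:: 0; 0; 2; 1], [:: 2; 2; 0; 1]);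
        ([:: 0; 3; 1; 2], [:: 1])]
  | sp_alpha => Frame
      [:: [:: -1; 0; 0]; [:: 0; -1; 0]; [:: 0; 0; -1]; [:: 1; 1; 1]]
      [:: ([:: 0; 1; 1; 1], [:: 1]); ([:: 1; 0; 1; 1], [:: 0; 1]);
        ([:: 1; 1; 0; 1], [:: 0; 0; 1])]
      [:: [:: -1; 0; 0]; [:: 0; 0; 1]; [:: 0; 1; -1]; [:: 1; -1; 0]]
      [:: ([:: 0; 1; 1; 1], [:: 1]); ([:: 0; 1; 1], [:: 1; 0; 0; 1]);
        ([:: 0; 1], [:: 1; 0; 1; 1])]
  | sp_epsilon => Frame
      [:: [:: -1; 0; 0]; [:: 0; -1; 0]; [:: 0; 1; -1]; [:: 1; 0; 1]]
      [:: ([:: 0; 1; 1; 1], [:: 1]); ([:: 1; 0; 1; 1], [:: 0; 1]);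
        ([:: 1; 0; 0; 1], [:: 0; 1; 1])]
      [:: [:: -1; 0; 0]; [:: 0; 0; -1]; [:: 0; -1; 1]; [:: 1; 1; 0]]
      [:: ([:: 0; 1; 1; 1], [:: 1]); ([:: 1; 0; 0; 1], [:: 0; 1; 1]);
        ([:: 1; 0; 1; 1], [:: 0; 1])]
  | sp_zeta => Frame
      [:: [:: -1; 0; 0]; [:: 0; 0; 1]; [:: 0; 1; 0]; [:: 1; -1; -2]]
      [:: ([:: 0; 2; 1; 1], [:: 1]); ([:: 0; 0; 1], [:: 1; 2; 0; 1]);
        ([:: 0; 1], [:: 1; 0; 1; 1])]
      [:: [:: -1; 0; 0]; [:: 0; -1; 0]; [:: 0; 1; -1]; [:: 1; 0; 1]]
      [:: ([:: 0; 1; 1; 1], [:: 1]); ([:: 1; 0; 1; 1], [:: 0; 1]);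
        ([:: 1; 0; 0; 1], [:: 0; 1; 1])]
  | sp_gamma => Frame
      [:: [:: -1; 0; 0]; [:: 0; -1; 0]; [:: 0; 0; 1]; [:: 0; 1; 0]; [:: 1; 0; -1]]
      [:: ([:: 0; 0; 1; 0; 1], [:: 1]); ([:: 0; 0; 0; 1], [:: 0; 1]);
        ([:: 0; 0; 1], [:: 1; 0; 0; 0; 1])]
      [:: [:: -1; 0; 0]; [:: 0; -1; 0]; [:: 0; 0; -1]; [:: 1; 1; 1]]
      [:: ([:: 0; 1; 1; 1], [:: 1]); ([:: 1; 0; 1; 1], [:: 0; 1]);
        ([:: 1; 1; 0; 1], [:: 0; 0; 1])]
  | sp_s7 => Frame
      [:: [:: -1; 0; 0]; [:: 0; -1; 0]; [:: 0; 1; -1]; [:: 1; 0; 1]]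
      [:: ([:: 0; 1; 1; 1], [:: 1]); ([:: 1; 0; 1; 1], [:: 0; 1]);
        ([:: 1; 0; 0; 1], [:: 0; 1; 1])]
      [:: [:: -1; 0; 0]; [:: 0; 0; -1]; [:: 0; -1; 1]; [:: 1; 1; 0]]
      [:: ([:: 0; 1; 1; 1], [:: 1]); ([:: 1; 0; 0; 1], [:: 0; 1; 1]);
        ([:: 1; 0; 1; 1], [:: 0; 1])]
  | sp_s10 => Frame
      [:: [:: -1; 0; 0]; [:: 0; 0; 1]; [:: 0; 1; -1]; [:: 1; -1; 0]]
      [:: ([:: 0; 1; 1; 1], [:: 1]); ([:: 0; 1; 1], [:: 1; 0; 0; 1]);
        ([:: 0; 1], [:: 1; 0; 1; 1])]
      [:: [:: -1; 0; 0]; [:: 0; -1; 0]; [:: 0; 0; -1]; [:: 1; 1; 1]]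
      [:: ([:: 0; 1; 1; 1], [:: 1]); ([:: 1; 0; 1; 1], [:: 0; 1]);
        ([:: 1; 1; 0; 1], [:: 0; 0; 1])]
  | sp_s18 => Frame
      [:: [:: 0; 0; 1]; [:: -2; 0; -1]; [:: 1; -3; -1]; [:: 1; 3; -1]]
      [:: ([:: 2; 0; 1; 1], [:: 1; 1]); ([:: 3; 1; 0; 2], [:: 3; 1; 2]);
        ([:: 1], [:: 0; 1; 1; 1])]
      [:: [:: 0; 0; -1]; [:: 1; 0; 0]; [:: -1; -1; 1]; [:: -1; 1; 1]]
      [:: ([:: 0; 1], [:: 2; 0; 1; 1]); ([:: 1; 1; 0; 1], [:: 1; 1; 1]);
        ([:: 0; 2; 1; 1], [:: 1])]
  | sp_eta => Frame [::] [::] [::] [::]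
  end.

End Data.

Definition certified (s : sporadic) (m : model) : bool :=
  lpcert (nvars s) (recurrence_data s) (scale m) (lpprod (factors m))
    (certificate m).

Lemma factored_model_certified s : certified s (factored_model s).
Proof. by case: s; vm_compute. Qed.

Lemma reflexive_model_certified s : certified s (reflexive_model s).
Proof. by case: s; vm_compute. Qed.

Lemma factored_model_ternary s :
  all (lpternary (nvars s)) (factors (factored_model s)).
Proof. by case: s; vm_compute. Qed.

Lemma reflexive_model_interior s : s <> sp_eta ->
  lpinterior (nvars s) (lpprod (factors (reflexive_model s)))
    (inequalities (frames s)) (inequality_weights (frames s))
    (points (frames s)) (point_weights (frames s)).
Proof. by case: s => // _; vm_compute. Qed.

Lemma sporadic_recurrence s u :
  is_sporadic_seq s u -> recurrence (recurrence_data s) u.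
Proof.
case: s => hu.
1-6: exact: zagier_recurrence.
all: exact: cooper_recurrence.
Qed.

Lemma certified_represents s m u : certified s m -> is_sporadic_seq s u ->
  CT_represents (laurent_of (nvars s) (lpprod (factors m))) u.
Proof.
move=> cert /sporadic_recurrence; apply: lpcert_CT cert => n.
by case: s; first [exact: zagier_lead_neq0 | exact: cooper_lead_neq0].
Qed.

Theorem theorem1p1 (R : realType) (s : sporadic) (u : nat -> rat)
    (hu : is_sporadic_seq s u) :
  (exists L : laurent (nvars s), CT_represents L u) /\
  (exists L : laurent (nvars s),
     CT_represents L u /\
     exists fs : seq (laurent (nvars s)),
       L = \prod_(f <- fs) f /\
       (forall f, f \in fs -> ternary_coefs f)) /\
  (s <> sp_eta ->
     exists L : laurent (nvars s),
       CT_represents L u /\ origin_only_interior_point R L).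
Proof.
have rep := certified_represents (factored_model_certified s) hu.
split; first by exists (laurent_of (nvars s) (lpprod (factors (factored_model s)))).
split=> [|s_eta].
  exists (laurent_of (nvars s) (lpprod (factors (factored_model s)))).
  split=> //; exists [seq laurent_of (nvars s) p | p <- factors (factored_model s)].
  split=> [|_ /mapP[p mp ->]]; first by rewrite laurent_of_prod big_map.
  exact: lpternaryP (allP (factored_model_ternary s) p mp).
exists (laurent_of (nvars s) (lpprod (factors (reflexive_model s)))); split.
  exact: certified_represents (reflexive_model_certified s) hu.
apply: lpinteriorP (reflexive_model_interior s_eta); by case: (s).
Qed.
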